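(* Let $I=[0,1]$ and let $\mathcal{H}^+(I)$ be the space of orientation preserving homeomorphisms of $I$. There is $f_*\in\mathcal{H}^+(I)$ whose conjugacy class is a dense $G_\delta$ subset of $\mathcal{H}^+(I)$.
   Context: For a compact metric space $(X,\mathrm{dist})$, $\mathcal{H}(X)$ denotes the space of homeomorphisms $f\colon X\to X$ with the $C^0$ distance $\mathrm{dist}_{C^0}(f,g)=\sup\{\mathrm{dist}(f(x),g(x)),\ \mathrm{dist}(f^{-1}(x),g^{-1}(x)) : x\in X\}$. For $I=[0,1]$ with the usual metric, $\mathcal{H}^+(I)=\{f\in\mathcal{H}(I): f \text{ preserves orientation}\}$, with the induced topology. Two homeomorphisms $f,g\in\mathcal{H}(X)$ are conjugate if there is $h\in\mathcal{H}(X)$ with $f\circ h=h\circ g$; the conjugacy class of $f$ is the set of all homeomorphisms conjugate to $f$. A set is $G_\delta$ if it is a countable intersection of open sets. *)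

(* Defs.v *)
From HB Require Import structures.
From mathcomp Require Import all_boot all_order all_algebra.
From mathcomp Require Import all_classical all_reals all_analysis.

Set Implicit Arguments.
Unset Strict Implicit.
Unset Printing Implicit Defensive.

Import Order.TTheory GRing.Theory Num.Theory.
Import numFieldNormedType.Exports.

Local Open Scope classical_set_scope.
Local Open Scope ring_scope.

HB.mixin Record isCompact T & Topological T := {
  compactT : compact [set: T]
}.

#[short(type="compactMetricType")]
HB.structure Definition CompactMetric (R : realType) :=
  { T of Metric R T & isCompact T }.

Record homeo (X : topologicalType) := Homeo {
  homeo_fun :> X -> X;
  homeo_inv : X -> X;
  homeo_funK : cancel homeo_fun homeo_inv;
  homeo_invK : cancel homeo_inv homeo_fun;
  homeo_cts : continuous homeo_fun;
  homeo_inv_cts : continuous homeo_inv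
}.

HB.instance Definition _ (X : topologicalType) := gen_eqMixin (homeo X).
HB.instance Definition _ (X : topologicalType) := gen_choiceMixin (homeo X).

(* On [0, 1] the conjugating h may reverse the orientation. *)
Definition homeo_conjugate (X : topologicalType) (f g : homeo X) :=
  exists h : homeo X, f \o h = h \o g.

Definition conjugacy_class (X : topologicalType) (f : homeo X) :
    set (homeo X) :=
  [set g | homeo_conjugate g f].

Lemma homeo_eq (X : topologicalType) (f g : homeo X) :
  f =1 g :> (X -> X) -> f = g.
Proof.
case: f g => [f f' fK f'K cf cf'] [g g' gK g'K cg cg'] /= /funext fg.
have fg' : f' = g'.
  by apply/funext => x; apply: (can_inj fK); rewrite f'K fg g'K.
by subst g g'; f_equal; exact: Prop_irrelevance.
Qed.

Section homeo_metric.
Context {R : realType} (X : compactMetricType R).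
Implicit Types f g h : homeo X.

Definition dist_C0_set f g : set R :=
  range (fun x => mdist (f x) (g x)) `|`
  range (fun x => mdist (homeo_inv f x) (homeo_inv g x)).

(* If X is empty, this is sup set0 = 0; otherwise compactness of X makes the
   set bounded, so that sup is the genuine supremum. *)
Definition dist_C0 f g : R := sup (dist_C0_set f g).

Lemma mdist_bounded : exists M : R, forall x y : X, mdist x y <= M.
Proof.
have /compact_near_coveringP cX := @compactT R X.
have [x0|nX] := pselect (exists x : X, True); last first.
  by exists 0 => x; exfalso; apply: nX; exists x.
case: x0 => a _.
have : \forall M \near +oo_R, [set: X] `<=` (fun x => mdist a x <= M).
  apply: cX => x _.
  exists (ball x 1, `]mdist a x + 1, +oo[%classic).
    split => /=; first exact: nbhsx_ballx.
    exists (mdist a x + 1); split; first exact: num_real.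
    by move=> z; rewrite /= in_itv/= andbT.
  move=> [y M] /= []; rewrite ballEmdist/= in_itv/= andbT => xy aM.
  apply: (le_trans (metric_triangle a x y)); apply: ltW; apply: lt_trans aM.
  by rewrite ltrD2l.
case=> M [_ MP].
have aM z : mdist a z <= M + 1 by apply: (MP (M + 1)) => //; rewrite ltrDl.
exists ((M + 1) + (M + 1)) => x y.
by apply: (le_trans (metric_triangle x a y)); rewrite lerD// metric_sym.
Qed.

Lemma dist_C0_set_ubound f g : has_ubound (dist_C0_set f g).
Proof.
by have [M HM] := mdist_bounded; exists M => _ [[x _ <-]|[x _ <-]]; exact: HM.
Qed.

Lemma dist_C0_ge f g x : mdist (f x) (g x) <= dist_C0 f g.
Proof.
by apply: ub_le_sup; [exact: dist_C0_set_ubound|left; exists x].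
Qed.

Lemma dist_C0_inv_ge f g x :
  mdist (homeo_inv f x) (homeo_inv g x) <= dist_C0 f g.
Proof.
by apply: ub_le_sup; [exact: dist_C0_set_ubound|right; exists x].
Qed.

Lemma dist_C0_le f g (M : R) : 0 <= M ->
  (forall x, mdist (f x) (g x) <= M) ->
  (forall x, mdist (homeo_inv f x) (homeo_inv g x) <= M) ->
  dist_C0 f g <= M.
Proof.
move=> M0 fgM fgM'; rewrite /dist_C0.
have [->|/set0P ne] := eqVneq (dist_C0_set f g) set0; first by rewrite sup0.
by apply: ge_sup => // _ [[x _ <-]|[x _ <-]].
Qed.

Lemma dist_C0_sym f g : dist_C0 f g = dist_C0 g f.
Proof.
rewrite /dist_C0; congr sup; apply/seteqP.
by split => _ [[x _ <-]|[x _ <-]]; [left|right|left|right];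
  exists x => //; exact: metric_sym.
Qed.

Lemma dist_C0_ge0 f g : 0 <= dist_C0 f g.
Proof.
have [[x _]|nX] := pselect (exists x : X, True).
  exact: le_trans (mdist_ge0 _ _) (dist_C0_ge f g x).
rewrite /dist_C0 (_ : dist_C0_set f g = set0) ?sup0//.
by rewrite -subset0 => d [[x _ _]|[x _ _]]; apply: nX; exists x.
Qed.

Lemma dist_C0_xx f : dist_C0 f f = 0.
Proof.
by apply/eqP; rewrite eq_le dist_C0_ge0 andbT; apply: dist_C0_le => // x;
  rewrite mdistxx.
Qed.

Lemma dist_C0_positivity f g : dist_C0 f g = 0 -> f = g.
Proof.
move=> fg0; apply: homeo_eq => x; apply: (@mdist_positivity R).
by apply/eqP; rewrite eq_le mdist_ge0 andbT -fg0 dist_C0_ge.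
Qed.

Lemma dist_C0_triangle g f h : dist_C0 f h <= dist_C0 f g + dist_C0 g h.
Proof.
apply: dist_C0_le => [|x|x]; first by rewrite addr_ge0// dist_C0_ge0.
- apply: (le_trans (metric_triangle _ (g x) _)).
  by rewrite lerD// dist_C0_ge.
- apply: (le_trans (metric_triangle _ (homeo_inv g x) _)).
  by rewrite lerD// dist_C0_inv_ge.
Qed.

HB.instance Definition _ := isMetric.Build R (homeo X)
  dist_C0_xx dist_C0_positivity dist_C0_sym dist_C0_triangle.

End homeo_metric.

Definition unit_interval (R : realType) : Type := `[0%R : R, 1%R]%classic.

Section unit_interval.
Context {R : realType}.
Local Notation I := (unit_interval R).

HB.instance Definition _ := PseudoMetric.on I.

Let dist (x y : I) : R := `|val x - val y|.

Let dist_ge0 x y : 0 <= dist x y. Proof. exact: normr_ge0. Qed.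

Let dist_positivity x y : dist x y = 0 -> x = y.
Proof. by move/normr0_eq0/eqP; rewrite subr_eq0 => /eqP /val_inj. Qed.

Let dist_ball x d : ball x d = [set y | dist x y < d].
Proof. by []. Qed.

HB.instance Definition _ :=
  PseudoMetric_isMetric.Build R I dist_ge0 dist_positivity dist_ball.

Lemma unit_interval_compact : compact [set: I].
Proof.
move=> F FF _; pose v : I -> R := val.
have Fv : (v @ F) `[0, 1]%classic.
  by apply: (@filterS _ F _ setT) filterT => y _; exact: set_mem (valP y).
have [p [p01 clp]] := @segment_compact R 0 1 (v @ F) _ Fv.
exists (exist _ p (mem_set p01)); split=> // A B FA [_ [[W oW <-] Wp sWB]].
have vA : (v @ F) (v @` A) by apply: (@filterS _ F _ A) FA => y Ay; exists y.
have [_ [[y Ay <-] Wy]] := clp _ _ vA (open_nbhs_nbhs (conj oW Wp)).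
by exists y; split=> //; exact: sWB.
Qed.

HB.instance Definition _ := isCompact.Build I unit_interval_compact.

End unit_interval.

(* Preserving the orientation of the interval means being increasing. *)
Definition Hplus (R : realType) : set (homeo (unit_interval R)) :=
  [set f | forall x y : unit_interval R, val x < val y -> val (f x) < val (f y)].

Arguments Hplus : clear implicits.

(* Main.v *)
Require Import Defs.
From HB Require Import structures.
From mathcomp Require Import all_boot all_order all_algebra.
From mathcomp Require Import all_classical all_reals all_analysis borel_hierarchy.
From mathcomp Require Import lra.

(** Call an increasing homeomorphism f of the interval alternating when, in
every neighbourhood of each of its fixed points, f x - x takes the signs
+, -, +, - at four successive points.  The theorem follows from three facts
about the set of alternating homeomorphisms.

It is a dense G_delta.  By compactness, being alternating amounts to countably
many open conditions: for every rational r and every d = 1/(n+1), either f has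
no fixed point within d of r or the pattern +, -, +, - appears within 2d of r
([alternating_uptoP]).  Each condition holds on a dense set, because the
pattern can be inserted next to any given fixed point by an arbitrarily small
perturbation ([perturb]); the space of increasing homeomorphisms is complete
([Hplus_complete]), so Baire's argument ([baire_complete]) gives density of
the intersection, and in particular an alternating homeomorphism.

It is invariant under conjugacy ([conjugate_alternating]).  A homeomorphism of
the interval is monotone; an increasing one transports the pattern as it is,
and a decreasing one reverses both the order of the four points and the four
signs, which gives back +, -, +, -.

Any two alternating homeomorphisms g and f are conjugate
([alternating_conjugate]).  This is a back-and-forth argument.  A finite
partial conjugacy matches finitely many g-orbits with f-orbits so that the
matching is increasing.  It extends to one more orbit, that of x: if x lies
between two successive points of a matched orbit, one chooses y between the
images of the two neighbours of x; otherwise, the matched orbits below x and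
those above x are separated on the side of f by fixed points, and alternation
supplies a point y between them that is moved in the required direction.
Running through the rationals one gets an increasing correspondence between
dense sets, whose completion is the conjugacy.

Conjugacies and perturbations are built from the order of the line alone.  A
homeomorphism in [Hplus] is extended by the identity to an increasing bijection
of the real line, handled together with its inverse; continuity is then
automatic. *)

Set Implicit Arguments.
Unset Strict Implicit.
Unset Printing Implicit Defensive.

Import Order.TTheory GRing.Theory Num.Theory.
Import numFieldNormedType.Exports.

Local Open Scope classical_set_scope.
Local Open Scope ring_scope.

(** * Increasing bijections of the line *)

Section order_automorphisms.
Context {R : realType}.
Implicit Types F G : R -> R.

(** The inverse is carried along because the distance between homeomorphisms
also compares inverses.  The symmetry between F and G also turns
each lemma about F into one about its inverse. *)
Definition order_aut F G :=
  [/\ {mono F : x y / x <= y}, cancel F G & cancel G F].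

Lemma order_aut_sym F G : order_aut F G -> order_aut G F.
Proof.
move=> [mF FK GK]; split; [move=> x y | exact: GK | exact: FK].
by rewrite -(mF (G x)) !GK.
Qed.

Lemma order_aut_lt F G : order_aut F G -> {mono F : x y / x < y}.
Proof. by move=> [mF _ _]; exact: leW_mono. Qed.

Lemma order_aut_leLR F G x y : order_aut F G -> (F x <= y) = (x <= G y).
Proof. by move=> [mF FK GK]; rewrite -[RHS]mF GK. Qed.

Lemma order_aut_leRL F G x y : order_aut F G -> (x <= F y) = (G x <= y).
Proof. by move=> FG; rewrite (order_aut_leLR _ _ (order_aut_sym FG)). Qed.

Lemma order_aut_ltLR F G x y : order_aut F G -> (F x < y) = (x < G y).
Proof. by move=> FG; rewrite !ltNge (order_aut_leRL _ _ FG). Qed.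

Lemma order_aut_ltRL F G x y : order_aut F G -> (x < F y) = (G x < y).
Proof. by move=> FG; rewrite !ltNge (order_aut_leLR _ _ FG). Qed.

Lemma order_aut_id : order_aut id id. Proof. by []. Qed.

Lemma order_aut_comp F G F' G' : order_aut F G -> order_aut F' G' ->
  order_aut (F \o F') (G' \o G).
Proof.
move=> [mF FK GK] [mF' FK' GK']; split => [x y|x|x] /=.
- by rewrite mF mF'.
- by rewrite FK FK'.
- by rewrite GK' GK.
Qed.

Lemma order_aut_iter F G n : order_aut F G -> order_aut (iter n F) (iter n G).
Proof.
move=> FG; elim: n => [|n IH]; first exact: order_aut_id.
have := order_aut_comp FG IH; congr (order_aut _ _); apply/funext => x //=.
by rewrite -iterSr.
Qed.

(** Both sides are inverse to each other because (F, G) and (F', G') are Galois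
connections: max F F' x <= y holds exactly when x <= min G G' y. *)
Lemma order_aut_max F G F' G' : order_aut F G -> order_aut F' G' ->
  order_aut (fun x => Num.max (F x) (F' x)) (fun y => Num.min (G y) (G' y)).
Proof.
move=> FG FG'.
have K x y : (Num.max (F x) (F' x) <= y) = (x <= Num.min (G y) (G' y)).
  by rewrite ge_max le_min (order_aut_leLR _ _ FG) (order_aut_leLR _ _ FG').
have K' x y : (y <= Num.max (F x) (F' x)) = (Num.min (G y) (G' y) <= x).
  by rewrite le_max ge_min (order_aut_leRL _ _ FG) (order_aut_leRL _ _ FG').
have FK : cancel (fun x => Num.max (F x) (F' x))
    (fun y => Num.min (G y) (G' y)).
  by move=> x; apply/eqP; rewrite eq_le -K -K' !lexx.
by split=> // [x y|y]; [rewrite K FK | apply/eqP; rewrite eq_le K K' !lexx].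
Qed.

Lemma order_aut_min F G F' G' : order_aut F G -> order_aut F' G' ->
  order_aut (fun x => Num.min (F x) (F' x)) (fun y => Num.max (G y) (G' y)).
Proof.
move=> /order_aut_sym FG /order_aut_sym FG'.
exact: order_aut_sym (order_aut_max FG FG').
Qed.

Lemma order_aut_affine (a b : R) : 0 < a ->
  order_aut (fun x => a * x + b) (fun y => (y - b) / a).
Proof.
move=> a0; split => [x y|x|y].
- by rewrite lerD2r ler_pM2l.
- by rewrite addrK mulrC mulKf // gt_eqF.
- by rewrite mulrC divfK ?subrK // gt_eqF.
Qed.

(** The reflection x |-> 1 - x exchanges the two ends of the interval; it halves
the work on statements that come in an upper and a lower form. *)
Lemma order_aut_flip F G : order_aut F G ->
  order_aut (fun x => 1 - F (1 - x)) (fun x => 1 - G (1 - x)).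
Proof.
move=> [mF FK GK]; split => [x y|x|y].
- by rewrite lerD2l lerN2 mF lerD2l lerN2.
- by rewrite !subKr FK subKr.
- by rewrite !subKr GK subKr.
Qed.

Lemma order_aut_fix F G c : order_aut F G -> F c = c -> G c = c.
Proof. by move=> [_ FK _] {1}<-; rewrite FK. Qed.

Lemma iter_fix F c n : F c = c -> iter n F c = c.
Proof. by move=> Fc; elim: n => //= n ->. Qed.

Lemma iter_lt F G x m n : order_aut F G -> x < F x ->
  (iter m F x < iter n F x) = (m < n)%N.
Proof.
move=> FG xF; have h i j : (i < j)%N -> iter i F x < iter j F x.
  elim: j => // j IH; rewrite ltnS leq_eqVlt => /predU1P[->|/IH].
    by rewrite iterSr (order_aut_lt (order_aut_iter j FG)).
  move=> /lt_trans; apply.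
  by rewrite iterSr (order_aut_lt (order_aut_iter j FG)).
case: (ltngtP m n) => [/h //|/h/ltW|->]; last by rewrite ltxx.
by rewrite leNgt => /negbTE.
Qed.

Lemma iter_gt F G x m n : order_aut F G -> F x < x ->
  (iter m F x < iter n F x) = (n < m)%N.
Proof.
move=> FG xF; have h i j : (i < j)%N -> iter j F x < iter i F x.
  elim: j => // j IH; rewrite ltnS leq_eqVlt => /predU1P[->|/IH].
    by rewrite iterSr (order_aut_lt (order_aut_iter j FG)).
  by apply: lt_trans; rewrite iterSr (order_aut_lt (order_aut_iter j FG)).
case: (ltngtP n m) => [/h //|/h/ltW|->]; last by rewrite ltxx.
by rewrite leNgt => /negbTE.
Qed.

End order_automorphisms.

(** * Fixed points bounding an orbit *)

Section orbit_limits.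
Context {R : realType}.
Implicit Types F G : R -> R.

Definition identity_outside F := forall x, x <= 0 \/ 1 <= x -> F x = x.

Definition one_signed F a b :=
  forall t t', a < t < b -> a < t' < b -> t < F t -> F t' < t' -> False.

(** An upward orbit that is bounded converges to a fixed point c, and F moves
every t between w and c upwards: if F t <= t, then all iterates of w would
stay below t, and so would c. *)
Lemma sup_orbit F G w B : order_aut F G -> w < F w ->
  (forall n, iter n F w <= B) ->
  exists c, [/\ F c = c, forall n, iter n F w <= c,
    forall B, (forall n, iter n F w <= B) -> c <= B &
    forall t, w < t < c -> t < F t].
Proof.
move=> FG wF wB; pose S := range (fun n => iter n F w).
have S0 : S !=set0 by exists w, 0%N.
have Sb : has_ubound S by exists B => _ [n _ <-].
have ub n : iter n F w <= sup S by apply: ub_le_sup => //; exists n.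
have lst C : (forall n, iter n F w <= C) -> sup S <= C.
  by move=> wC; apply: ge_sup => // _ [n _ <-].
exists (sup S); split => // [|t /andP[wt tS]].
- have [mF _ _] := FG.
  apply/eqP; rewrite eq_le (order_aut_leLR _ _ FG); apply/andP; split.
    by apply: lst => n; rewrite -(order_aut_leLR _ _ FG); exact: (ub n.+1).
  apply: lst => n; apply: (@le_trans _ _ (iter n.+1 F w)).
    by rewrite ltW// (iter_lt _ _ FG wF).
  by rewrite /= mF.
- rewrite ltNge; apply/negP => Ft.
  move: tS; rewrite ltNge => /negP; apply; apply: lst => n.
  have : iter n F t <= t.
    elim: n => //= n IH; apply: le_trans Ft; by case: FG => ->.
  apply: le_trans; have [mF _ _] := order_aut_iter n FG.
  by rewrite mF ltW.
Qed.

(** For finitely many orbits on the side of f, this is the largest of the limits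
of the upward orbits, taking the orbit under the inverse when f moves the point
downwards; it is 0 when there is no orbit.  It is the least nonnegative bound
of the orbits, by the last clause, and f keeps one sign immediately below it.
At 0 the sign clause holds because f is the identity on the left of 0. *)
Lemma fixed_above F G (ws : seq R) : order_aut F G -> identity_outside F ->
  (forall w, w \in ws -> F w <> w) ->
  exists c, [/\ F c = c, 0 <= c, exists2 a, a < c & one_signed F a c,
    forall w, w \in ws -> w <= c &
    forall B, 0 <= B ->
      (forall w n, w \in ws -> iter n F w <= B /\ iter n G w <= B) -> c <= B].
Proof.
move=> FG F01; have GF := order_aut_sym FG.
elim: ws => [|w ws IH] ws_nfix.
  exists 0; split => //; first by apply: F01; left.
  exists (-1) => [|t t' /andP[_ t0] _]; first lra.
  by rewrite F01 ?ltxx//; left; exact: ltW.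
have {IH}[|c [Fc c0 cs wsc cB]] := IH.
  by move=> v vws; apply: ws_nfix; rewrite inE vws orbT.
have [wc|cw] := leP w c.
  exists c; split => // [v|B B0 HB].
    by rewrite inE => /predU1P[->|/wsc].
  by apply: cB => // v n vws; apply: HB; rewrite inE vws orbT.
have w1 : w < 1.
  rewrite ltNge; apply/negP => w1; apply: (ws_nfix w); first exact: mem_head.
  by apply: F01; right.
have K H K : order_aut H K -> identity_outside H -> w < H w -> exists d,
    [/\ H d = d, w <= d, forall B, (forall n, iter n H w <= B) -> d <= B &
        forall t, w < t < d -> t < H t].
  move=> HK H01 wH; have [n|d [? wd ? ?]] := @sup_orbit H K w 1 HK wH.
    have [mH _ _] := order_aut_iter n HK.
    by rewrite -[leRHS](@iter_fix _ H _ n) ?mH ?ltW// H01//; right.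
  by exists d; split => //; exact: (wd 0%N).
have G01 : identity_outside G by move=> x /F01; exact: order_aut_fix.
have [d [Fd wd dB ds]] : exists d, [/\ F d = d, w <= d,
    forall B, (forall n, iter n F w <= B /\ iter n G w <= B) -> d <= B &
    one_signed F w d].
  have [Fw|wF|Fw] := ltgtP (F w) w; last first.
  - by case: (ws_nfix w); rewrite ?mem_head.
  - have [d [Gd wd dB ds]] := K _ _ FG F01 wF.
    exists d; split => //; first by move=> B HB; apply: dB => n; case: (HB n).
    by move=> t t' _ /ds tF _ Ft; have := lt_trans tF Ft; rewrite ltxx.
  - have [|d [Gd wd dB ds]] := K _ _ GF G01.
      by rewrite -(order_aut_ltLR _ _ FG).
    exists d; split => //; first exact: order_aut_fix Gd.
      by move=> B HB; apply: dB => n; case: (HB n).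
    move=> t t' /ds; rewrite -(order_aut_ltLR _ _ FG) => tF _ Ft _.
    by have := lt_trans tF Ft; rewrite ltxx.
exists d; split => //.
- exact: le_trans c0 (le_trans (ltW cw) wd).
- exists w => //; rewrite lt_neqAle wd andbT; apply/eqP => wd'.
  by apply: (ws_nfix w); rewrite ?mem_head// wd'.
- move=> v; rewrite inE => /predU1P[->//|/wsc vc].
  exact: le_trans vc (le_trans (ltW cw) wd).
- by move=> B _ HB; apply: dB => n; apply: HB; rewrite mem_head.
Qed.

Lemma iter_flip F n x :
  iter n (fun x => 1 - F (1 - x)) (1 - x) = 1 - iter n F x.
Proof. by elim: n => //= n ->; rewrite subKr. Qed.

Lemma fixed_below F G (ws : seq R) : order_aut F G -> identity_outside F ->
  (forall w, w \in ws -> F w <> w) ->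
  exists c, [/\ F c = c, c <= 1, exists2 b, c < b & one_signed F c b,
    forall w, w \in ws -> c <= w &
    forall B, B <= 1 ->
      (forall w n, w \in ws -> B <= iter n F w /\ B <= iter n G w) -> B <= c].
Proof.
move=> FG F01 nfix; have := @fixed_above _ _ (map (fun w => 1 - w) ws)
  (order_aut_flip FG).
case=> [x x01|_ /mapP[w wws ->]|c [Fc c0 [a ac os] wc cB]].
- by rewrite F01 ?subKr//; lra.
- by rewrite subKr => e; apply: (nfix w wws); lra.
exists (1 - c); split; [lra|lra| | |].
- exists (1 - a); first lra.
  move=> t t' tac tac' tF Ft.
  by apply: (os (1 - t') (1 - t)); rewrite ?subKr; lra.
- by move=> w wws; have := wc _ (map_f _ wws); lra.
- move=> B B1 HB; have : c <= 1 - B; last lra.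
  apply: cB; first lra.
  move=> _ n /mapP[w wws ->]; rewrite !iter_flip.
  by have := HB w n wws; lra.
Qed.

End orbit_limits.

(** * Increasing matchings of orbits *)

Section back_and_forth.
Context {R : realType}.
Implicit Types (f g : R -> R) (E : R -> R -> Prop) (s : seq (R * R)).

Definition alternates f a b :=
  exists x1 x2 x3 x4, [/\ a < x1, x1 < x2, x2 < x3, x3 < x4 & x4 < b] /\
    [/\ x1 < f x1, f x2 < x2, x3 < f x3 & f x4 < x4].

Definition alternating f := forall c, 0 <= c <= 1 -> f c = c ->
  forall d, 0 < d -> alternates f (c - d) (c + d).

(** A relation of this kind is the graph of an increasing bijection between
its domain and its range. *)
Definition order_rel E :=
  forall z w z' w', E z w -> E z' w' -> (z <= z') = (w <= w').

Definition equivariant_rel g f E := forall z w, E z w -> E (g z) (f w).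

(** The pairs (g^k p.1, f^k p.2) for an integer k, positive or negative; two
natural exponents are used so as not to mention inverses. *)
Definition orbit_rel g f (p : R * R) z w :=
  exists m n, iter m g z = iter n g p.1 /\ iter m f w = iter n f p.2.

(** The points outside the open unit interval are matched with themselves; this
gives every point of the interval matched points on both sides. *)
Definition orbits_rel g f s z w :=
  (z = w /\ (z <= 0 \/ 1 <= z)) \/ exists2 p, p \in s & orbit_rel g f p z w.

Lemma order_rel_lt E z w z' w' : order_rel E -> E z w -> E z' w' ->
  (z < z') = (w < w').
Proof. by move=> oE zw zw'; rewrite !ltNge (oE _ _ _ _ zw' zw). Qed.

Lemma orbits_rel_equivariant g f s :
  identity_outside g -> identity_outside f ->
  equivariant_rel g f (orbits_rel g f s).
Proof.
move=> g01 f01 z w [[-> w01]|[p ps [m [n [Hz Hw]]]]].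
  by left; rewrite g01 // f01.
right; exists p => //; exists m, n.+1; split; first by rewrite -iterSr /= Hz.
by rewrite -iterSr /= Hw.
Qed.

Lemma orbits_rel_equivariantV g g' f f' s :
  order_aut g g' -> order_aut f f' ->
  identity_outside g -> identity_outside f ->
  equivariant_rel g' f' (orbits_rel g f s).
Proof.
move=> gg ff g01 f01 z w [[-> w01]|[p ps [m [n [Hz Hw]]]]].
  left; rewrite (order_aut_fix gg (g01 _ w01)).
  by rewrite (order_aut_fix ff (f01 _ w01)).
right; exists p => //; exists m.+1, n; rewrite !iterSr.
by case: gg ff => [_ _ ->] [_ _ ->].
Qed.

Lemma equivariant_iter g f E n z w : equivariant_rel g f E -> E z w ->
  E (iter n g z) (iter n f w).
Proof. by move=> eE zw; elim: n => //= n; exact: eE. Qed.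

Lemma orbits_rel_swap g f s z w : orbits_rel g f s z w ->
  orbits_rel f g (map (fun p => (p.2, p.1)) s) w z.
Proof.
case=> [[-> ?]|[p ps [m [n [? ?]]]]]; [by left|right].
exists (p.2, p.1); last by exists m, n.
by apply/mapP; exists p.
Qed.

Lemma orbit_rel_mem g f s p : p \in s -> orbits_rel g f s p.1 p.2.
Proof. by move=> ps; right; exists p => //; exists 0%N, 0%N. Qed.

(** The points differ by a power of g, whose exponent is positive as z < z'. *)
Lemma orbit_gap g g' z z' m n : order_aut g g' ->
  iter m g z = iter n g z' -> z < z' -> z < g z -> g z <= z'.
Proof.
move=> gg mn zz' zg; have [mN _ _] := order_aut_iter n gg.
have [nm|mn'] := ltnP n m.
  by rewrite -mN -iterSr -mn leNgt (iter_lt _ _ gg zg) -leqNgt.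
have : iter n g z < iter m g z by rewrite mn (leW_mono mN).
by rewrite (iter_lt _ _ gg zg) ltnNge mn'.
Qed.

Lemma orbit_gapV g g' z z' m n : order_aut g g' ->
  iter m g z = iter n g z' -> z < z' -> g z' < z' -> z <= g z'.
Proof.
move=> gg mn zz' zg; have [mM _ _] := order_aut_iter m gg.
have [nm|mn'] := ltnP m n.
  by rewrite -mM -iterSr mn leNgt (iter_gt _ _ gg zg) -leqNgt.
have : iter n g z' < iter m g z' by rewrite -mn (leW_mono mM).
by rewrite (iter_gt _ _ gg zg) ltnNge mn'.
Qed.

Lemma orbit_window g g' a b z z' m n : order_aut g g' -> b = g a \/ a = g b ->
  a <= z < b -> a <= z' < b -> iter m g z = iter n g z' -> z <= z'.
Proof.
move=> gg ab /andP[az zb] /andP[az' zb'] mn; rewrite leNgt; apply/negP => zz.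
have [mg _ _] := gg; have mgl := leW_mono mg.
case: ab => [bE|aE].
  have zg : z' < g z' by apply: lt_le_trans zb' _; rewrite bE mg.
  have := orbit_gap gg (esym mn) zz zg; apply/negP; rewrite -ltNge.
  by apply: lt_le_trans zb _; rewrite bE mg.
have zg : g z < z by apply: lt_le_trans az; rewrite aE mgl.
have := orbit_gapV gg (esym mn) zz zg; apply/negP; rewrite -ltNge.
by apply: lt_le_trans az'; rewrite aE mgl.
Qed.

(** A half-open interval between a point and its image contains at most one
point of each orbit, hence finitely many matched points. *)
Lemma orbits_rel_window g g' f s a b : order_aut g g' -> identity_outside g ->
  a < b -> b = g a \/ a = g b ->
  exists t : seq R, forall z w, orbits_rel g f s z w -> a <= z < b -> z \in t.
Proof.
move=> gg g01 ab gab; have mgl := order_aut_lt gg.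
elim: s => [|p s [t tP]].
  exists [:: a] => z w [[-> w01]|[]//] /andP[aw wb]; rewrite inE eq_le aw andbT.
  rewrite leNgt; apply/negP => aw'; have gw := g01 _ w01.
  case: gab => [bE|aE].
    by move: wb; rewrite bE -gw mgl ltNge ltW.
  by move: aw'; rewrite aE -gw mgl ltNge ltW.
have [[z0 [w0 [zw0 zab]]]|nop] :=
    pselect (exists z w, orbit_rel g f p z w /\ a <= z < b).
  exists (z0 :: t) => z w E zab'; rewrite inE.
  case: E => [zw|[q]].
    by rewrite (tP z w) ?orbT //; left.
  rewrite inE => /predU1P[-> [m [n [Hz _]]]|qs zw]; last first.
    by rewrite (tP z w) ?orbT //; right; exists q.
  have [m0 [n0 [Hz0 _]]] := zw0.
  have e : iter (n0 + m) g z = iter (n + m0) g z0.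
    by rewrite !iterD Hz Hz0 -!iterD addnC.
  by rewrite eq_le (orbit_window gg gab zab' zab e)
    (orbit_window gg gab zab zab' (esym e)).
exists t => z w E zab; case: E => [zw|[q]].
  by apply: (tP z w) => //; left.
rewrite inE => /predU1P[-> zw|qs zw].
  by case: nop; exists z, w.
by apply: (tP z w) => //; right; exists q.
Qed.

Lemma seq_extremum (r : rel R) (P : R -> Prop) (t : seq R) x :
  total r -> transitive r -> x \in t -> P x ->
  exists l, P l /\ forall z, z \in t -> P z -> r z l.
Proof.
move=> tot tr; elim: t x => // a t IH x.
have [[y [yt Py]]|nP] := pselect (exists y, y \in t /\ P y); last first.
  rewrite inE => /predU1P[-> Pa|xt Px]; last by case: nP; exists x.
  exists a; split => // z; rewrite inE => /predU1P[->|zt Pz].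
    by have := tot a a; rewrite orbb.
  by case: nP; exists z.
move=> _ _; have [l [Pl lP]] := IH y yt Py.
have [Pa|nPa] := pselect (P a); last first.
  by exists l; split => // z; rewrite inE => /predU1P[->//|]; exact: lP.
have /orP[al|la] := tot a l.
  by exists l; split => // z; rewrite inE => /predU1P[->//|]; exact: lP.
exists a; split => // z; rewrite inE => /predU1P[->|zt Pz].
  by have := tot a a; rewrite orbb.
exact: tr (lP z zt Pz) la.
Qed.

(** The point y is a legitimate image for the orbit of a new point x: it lies in
the same cut and is moved in the same direction.  Equivariance of E then takes
care of all the iterates of x. *)
Definition fits g f E x y :=
  [/\ forall z w, E z w -> z < x -> w < y, forall z w, E z w -> x < z -> y < w &
    (x < g x /\ y < f y) \/ (g x < x /\ f y < y)].

(** Finitely many matched points lie between z0 and g z0, so x has a matched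
predecessor l and a matched successor u there; any point between their images
fits, and it moves upwards as it lies between w0 and f w0. *)
Lemma fits_straddle g g' f f' E x z0 w0 (t : seq R) :
  order_aut g g' -> order_aut f f' ->
  order_rel E -> equivariant_rel g f E ->
  (forall z w, E z w -> z0 <= z < g z0 -> z \in t) ->
  E z0 w0 -> z0 < x < g z0 -> ~ (exists y, E x y) ->
  exists y, fits g f E x y /\ x < g x.
Proof.
move=> gg ff oE eE tP E0 /andP[z0x xgz0] nx.
have mgl := order_aut_lt gg; have [mf _ _] := ff.
have [||l [[[wl El] /andP[z0l lx]] lP]] := @seq_extremum <=%R
    (fun z => (exists w, E z w) /\ z0 <= z < x) t z0 (@le_total _ R) le_trans
    (tP _ _ E0 _).
- by rewrite lexx (lt_trans z0x).
- by split; [exists w0 | rewrite lexx].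
(* The point g z0 is added to the list, which covers only the half-open
   interval, as the default successor. *)
have [|u [[[wu Eu] /andP[xu ugz0]] uP]] := @seq_extremum >=%R
    (fun z => (exists w, E z w) /\ x < z <= g z0) (g z0 :: t) (g z0)
    (fun a b => le_total b a) ge_trans (mem_head _ _).
  by split; [exists (f w0); exact: eE | rewrite lexx xgz0].
have wlu : wl < wu by rewrite -(order_rel_lt oE El Eu) (lt_trans lx).
have low z w : E z w -> z < x -> w <= wl.
  move=> zw zx; rewrite -(oE _ _ _ _ zw El).
  have [zz0|z0z] := leP z z0; first exact: le_trans zz0 z0l.
  apply: lP; last by split; [exists w | rewrite (ltW z0z)].
  by apply: (tP _ _ zw); rewrite (ltW z0z) (lt_trans zx).
have up z w : E z w -> x < z -> wu <= w.
  move=> zw xz; rewrite -(oE _ _ _ _ Eu zw).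
  have [zz0|z0z] := leP (g z0) z; first exact: le_trans ugz0 zz0.
  apply: uP; last by split; [exists w | rewrite xz ltW].
  by rewrite inE (tP _ _ zw) ?orbT// z0z ltW// (lt_trans z0x).
exists ((wl + wu) / 2); split; last by apply: lt_trans xgz0 _; rewrite mgl.
split => [z w zw zx|z w zw xz|].
- by have := low _ _ zw zx; lra.
- by have := up _ _ zw xz; lra.
left; split; first by apply: lt_trans xgz0 _; rewrite mgl.
have h1 : wu <= f w0 by rewrite -(oE _ _ _ _ Eu (eE _ _ E0)).
have h2 : f w0 <= f ((wl + wu) / 2).
  by rewrite mf; have := low _ _ E0 z0x; lra.
by lra.
Qed.

End back_and_forth.

(** * Adding an orbit to a partial conjugacy *)

Section extension.
Context {R : realType} (g g' f f' : R -> R).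
Hypotheses (gg : order_aut g g') (ff : order_aut f f').
Hypotheses (g01 : identity_outside g) (f01 : identity_outside f).
Hypothesis falt : alternating f.
Implicit Types (s : seq (R * R)) (E : R -> R -> Prop).

(** Only moved points are matched, so that the limits given by [fixed_above] and
[fixed_below] are limits of nonconstant orbits. *)
Definition partial_conj s :=
  (forall p, p \in s -> g p.1 <> p.1) /\ order_rel (orbits_rel g f s).

Lemma partial_conj_nfix s p : partial_conj s -> p \in s -> f p.2 <> p.2.
Proof.
move=> [nfix os] ps fp; have Ep := orbit_rel_mem g f ps.
have Eg := orbits_rel_equivariant g01 f01 Ep.
apply: (nfix p ps); apply/eqP.
by rewrite eq_le (os _ _ _ _ Ep Eg) (os _ _ _ _ Eg Ep) fp lexx.
Qed.

(** When no matched orbit straddles x, each of them lies entirely on one side of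
x.  On the side of f, the lower ones are bounded by a fixed point a and the
upper ones by a fixed point b with a <= b.  Near a, the pattern +, -, +, - is
found, but f has one sign immediately below a, which leaves room there for the
first point at most; hence points moved downwards and points moved upwards are
found immediately above a.  This excludes a = b, since
f has one sign immediately above b, and supplies y between a and b. *)
Lemma fits_fresh s x : partial_conj s -> g x <> x ->
  ~ (exists y, orbits_rel g f s x y) ->
  (forall z w, orbits_rel g f s z w -> ~ (z < x < g z) /\ ~ (g z < x < z)) ->
  exists y, fits g f (orbits_rel g f s) x y.
Proof.
set E := orbits_rel g f s => pc gx nx nstr.
have [snfix oE] := pc.
have eE : equivariant_rel g f E := orbits_rel_equivariant g01 f01.
have eE' : equivariant_rel g' f' E := orbits_rel_equivariantV gg ff g01 f01.
have E01 c : c <= 0 \/ 1 <= c -> E c c by left.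
have x01 : 0 < x < 1.
  by rewrite !ltNge; apply/andP; split; apply/negP => ?; apply: gx; apply: g01;
    [left|right].
have [[x0 x1] [_ gK' g'K]] := (andP x01, gg).
have neq z w : E z w -> z <> x.
  by move=> zw zx; apply: nx; exists w; rewrite -zx.
(* Each matched orbit stays on its side of x. *)
have side z w : E z w -> (g z < x) = (z < x).
  move=> zw; have [gzx|xgz|gzx] := ltgtP (g z) x; last 2 first.
  - have [zx|//|zx] := ltgtP z x; last by case: (neq _ _ zw).
    by case: (nstr z w zw) => []; rewrite zx xgz.
  - by case: (neq _ _ (eE _ _ zw)).
  - have [//|xz|zx] := ltgtP z x; last by case: (neq _ _ zw).
    by case: (nstr z w zw) => _ []; rewrite xz gzx.
have side' z w : E z w -> (g' z < x) = (z < x).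
  by move=> zw; rewrite -(side _ _ (eE' _ _ zw)) g'K.
have sideN n z w : E z w -> (iter n g z < x) = (z < x).
  by move=> zw; elim: n => //= n <-; exact: side (equivariant_iter n eE zw).
have sideN' n z w : E z w -> (iter n g' z < x) = (z < x).
  by move=> zw; elim: n => //= n <-; exact: side' (equivariant_iter n eE' zw).
have cross z w z' w' : E z w -> E z' w' -> z < x -> ~~ (z' < x) -> w <= w'.
  move=> zw zw' zx; rewrite -leNgt => xz'; rewrite -(oE _ _ _ _ zw zw').
  exact: le_trans (ltW zx) xz'.
pose low := [seq p.2 | p <- s & p.1 < x].
pose up := [seq p.2 | p <- s & ~~ (p.1 < x)].
have lowP w : w \in low -> exists2 z, (z, w) \in s & z < x.
  by case/mapP => [[z v]]; rewrite mem_filter => /= /andP[zx zs] ->; exists z.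
have upP w : w \in up -> exists2 z, (z, w) \in s & ~~ (z < x).
  by case/mapP => [[z v]]; rewrite mem_filter => /= /andP[zx zs] ->; exists z.
have lnfix w : w \in low -> f w <> w.
  by case/lowP => z zs _; exact: (partial_conj_nfix pc zs).
have unfix w : w \in up -> f w <> w.
  by case/upP => z zs _; exact: (partial_conj_nfix pc zs).
have sE z w : (z, w) \in s -> E z w by exact: orbit_rel_mem.
have crossN n z w z' w' : E z w -> E z' w' -> z < x -> ~~ (z' < x) ->
    w <= iter n f w' /\ w <= iter n f' w'.
  move=> zw zw' zx z'x; split.
    apply: (cross _ _ _ _ zw (equivariant_iter n eE zw')) => //.
    by rewrite (sideN _ _ _ zw').
  apply: (cross _ _ _ _ zw (equivariant_iter n eE' zw')) => //.
  by rewrite (sideN' _ _ _ zw').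
have [b [fb b1 [b' bb' bos] upb bB]] := fixed_below ff f01 unfix.
have [a [fa a0 [a' a'a aos] lowa aB]] := fixed_above ff f01 lnfix.
have b0 : 0 <= b.
  apply: bB => // w n /upP[z zs zx].
  exact: crossN n _ _ _ _ (E01 0 (or_introl (lexx _))) (sE _ _ zs) x0 zx.
have ab : a <= b.
  apply: aB => // w n /lowP[z zs zx]; have zw := sE _ _ zs.
  have key v : E v.1 v.2 -> v.1 < x -> v.2 <= b.
    move=> Ev vx; apply: bB => [|w2 n2 /upP[z2 zs2 zx2]].
      apply: (cross _ _ _ _ Ev (E01 1 (or_intror (lexx _)))) => //.
      by rewrite -leNgt ltW.
    exact: crossN n2 _ _ _ _ Ev (sE _ _ zs2) vx zx2.
  split.
    apply: (key (_, _) (equivariant_iter n eE zw)).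
    by rewrite /= (sideN _ _ _ zw).
  apply: (key (_, _) (equivariant_iter n eE' zw)).
  by rewrite /= (sideN' _ _ _ zw).
have belowa z w : E z w -> z < x -> w <= a.
  move=> zw zx; case: (zw) => [[zwE [z0|z1]]|[p ps [m [n [Hz Hw]]]]].
  - by rewrite -zwE; exact: le_trans a0.
  - by have := lt_trans zx x1; rewrite ltNge z1.
  have px : p.1 < x.
    by rewrite -(sideN n _ _ (orbit_rel_mem g f ps)) -Hz (sideN _ _ _ zw).
  have pa : p.2 <= a.
    by apply: lowa; apply/mapP; exists p; rewrite ?mem_filter ?px.
  have [mm _ _] := order_aut_iter m ff; have [mn _ _] := order_aut_iter n ff.
  by rewrite -mm Hw (iter_fix m fa) -(iter_fix n fa) mn.
have aboveb z w : E z w -> ~~ (z < x) -> b <= w.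
  move=> zw zx; case: (zw) => [[zwE [z0|z1]]|[p ps [m [n [Hz Hw]]]]].
  - by move: zx; rewrite (le_lt_trans z0 x0).
  - by rewrite -zwE; exact: le_trans z1.
  have px : ~~ (p.1 < x).
    by rewrite -(sideN n _ _ (orbit_rel_mem g f ps)) -Hz (sideN _ _ _ zw).
  have pb : b <= p.2.
    by apply: upb; apply/mapP; exists p; rewrite ?mem_filter ?px.
  have [mm _ _] := order_aut_iter m ff; have [mn _ _] := order_aut_iter n ff.
  by rewrite -mm Hw (iter_fix m fb) -(iter_fix n fb) mn.
have a01 : 0 <= a <= 1 by rewrite a0 (le_trans ab).
(* Below a there is room for the first point of the pattern at most, so its
   second and third points lie above a. *)
have right_of_a d : 0 < d -> d <= a - a' -> exists y1 y2,
    [/\ a < y1, y1 < y2, y2 < a + d, f y1 < y1 & y2 < f y2].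
  move=> d0 da.
  have [x1' [x2 [x3 [x4 [[? ? ? ? ?] [fx1 fx2 fx3 fx4]]]]]] := falt a01 fa d0.
  exists x2, x3; split => //; last lra.
  rewrite ltNge; apply/negP => x2a.
  have x2a' : x2 < a.
    rewrite lt_neqAle x2a andbT; apply/eqP => e.
    by move: fx2; rewrite e fa ltxx.
  by apply: (aos x1' x2) => //; lra.
have ltab : a < b.
  rewrite lt_neqAle ab andbT; apply/eqP => e.
  have [||y1 [y2 [? ? ? fy1 fy2]]] := right_of_a (Num.min (a - a') (b' - b)).
  - by rewrite lt_min; lra.
  - by rewrite ge_min lexx.
  have := ge_min (b' - b) (a - a') (b' - b); rewrite lexx orbT => h.
  by apply: (bos y2 y1) => //; lra.
have [||y1 [y2 [? ? ? fy1 fy2]]] := right_of_a (Num.min (a - a') (b - a)).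
- by rewrite lt_min; lra.
- by rewrite ge_min lexx.
have := ge_min (b - a) (a - a') (b - a); rewrite lexx orbT => h.
have fit y : a < y < b -> (x < g x /\ y < f y) \/ (g x < x /\ f y < y) ->
    fits g f E x y.
  move=> /andP[ay yb]; split => // [z w zw zx|z w zw xz].
    exact: le_lt_trans (belowa _ _ zw zx) ay.
  by apply: lt_le_trans yb (aboveb _ _ zw _); rewrite -leNgt ltW.
have [gxx|xgx|//] := ltgtP (g x) x.
- by exists y1; apply: fit; [lra|right].
- by exists y2; apply: fit; [lra|left].
Qed.

Lemma partial_conj_fits s x : partial_conj s -> g x <> x ->
  ~ (exists y, orbits_rel g f s x y) ->
  exists y, fits g f (orbits_rel g f s) x y.
Proof.
set E := orbits_rel g f s => pc gx nx.
have [snfix oE] := pc.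
have eE : equivariant_rel g f E := orbits_rel_equivariant g01 f01.
have eE' : equivariant_rel g' f' E := orbits_rel_equivariantV gg ff g01 f01.
have [[z0 [w0 [zw0 zx]]]|n1] := pselect (exists z w, E z w /\ z < x < g z).
  have [t tP] := orbits_rel_window f s gg g01
    (lt_trans (andP zx).1 (andP zx).2) (or_introl erefl).
  by have [y [yf _]] := fits_straddle gg ff oE eE tP zw0 zx nx; exists y.
have [[z0 [w0 [zw0 zx]]]|n2] := pselect (exists z w, E z w /\ g z < x < z).
  have [_ gK g'K] := gg.
  have [t tP] := orbits_rel_window f s gg g01
    (lt_trans (andP zx).1 (andP zx).2) (or_intror erefl).
  (* Where g moves downwards, its inverse moves upwards, from g z0 to z0. *)
  have [||y [[y1 y2 ys] xg]] := fits_straddle (order_aut_sym gg)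
    (order_aut_sym ff) oE eE' (z0 := g z0) (t := t) _ (eE _ _ zw0) _ nx.
  - by move=> z w zw; rewrite gK; exact: tP zw.
  - by rewrite gK.
  exists y; split => //; move: xg ys.
  rewrite -(order_aut_ltLR _ _ gg) -(order_aut_ltRL _ _ gg).
  rewrite -(order_aut_ltLR _ _ ff) -(order_aut_ltRL _ _ ff) => xg [[? ?]|[? ?]].
    by right.
  by left.
apply: fits_fresh => // z w zw; split => H.
  by apply: n1; exists z, w.
by apply: n2; exists z, w.
Qed.

(** Comparing two points of the enlarged matching reduces, after applying powers
of g and f, to comparing x with an old point, which is what [fits] gives, or
two iterates of x, where only the direction in which x moves matters. *)
Lemma partial_conj_cons s x y : partial_conj s -> g x <> x ->
  ~ (exists y, orbits_rel g f s x y) ->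
  fits g f (orbits_rel g f s) x y -> partial_conj ((x, y) :: s).
Proof.
set E := orbits_rel g f s => -[snfix oE] gx nx [Elow Eup sgn].
have eE : equivariant_rel g f E := orbits_rel_equivariant g01 f01.
have eE' : equivariant_rel g' f' E := orbits_rel_equivariantV gg ff g01 f01.
split => [p|]; first by rewrite inE => /predU1P[->//|]; exact: snfix.
have split_rel z w : orbits_rel g f ((x, y) :: s) z w ->
    E z w \/ orbit_rel g f (x, y) z w.
  case=> [zw|[q]]; first by left; left.
  rewrite inE => /predU1P[-> //|qs zw]; first by right.
  by left; right; exists q.
have moved z w m n : E z w ->
    E (iter n g' (iter m g z)) (iter n f' (iter m f w)).
  by move=> zw; apply: (equivariant_iter _ eE'); apply: (equivariant_iter _ eE).
have cmp u v : E u v -> (u <= x) = (v <= y) /\ (x <= u) = (y <= v).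
  move=> uv; have [ux|xu|e] := ltgtP u x.
  - by have := Elow _ _ uv ux; case: ltgtP.
  - by have := Eup _ _ uv xu; case: ltgtP.
  - by case: nx; exists v; rewrite -e.
move=> z w z' w' /split_rel[zw|[m [n [/= Hz Hw]]]]
  /split_rel[zw'|[m' [n' [/= Hz' Hw']]]].
- exact: oE.
- have [mm _ _] := order_aut_iter m' gg; have [mf _ _] := order_aut_iter m' ff.
  rewrite -mm -[RHS]mf Hz' Hw' (order_aut_leRL _ _ (order_aut_iter n' gg)).
  rewrite (order_aut_leRL _ _ (order_aut_iter n' ff)).
  exact: (cmp _ _ (moved _ _ _ _ zw)).1.
- have [mm _ _] := order_aut_iter m gg; have [mf _ _] := order_aut_iter m ff.
  rewrite -mm -[RHS]mf Hz Hw (order_aut_leLR _ _ (order_aut_iter n gg)).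
  rewrite (order_aut_leLR _ _ (order_aut_iter n ff)).
  exact: (cmp _ _ (moved _ _ _ _ zw')).2.
- have [mm _ _] := order_aut_iter (m' + m) gg.
  have [mf _ _] := order_aut_iter (m' + m) ff.
  rewrite -mm -[RHS]mf {2 4}(addnC m') !iterD Hz Hw Hz' Hw' -!iterD !leNgt.
  case: sgn => [[xg yf]|[xg yf]].
    by rewrite (iter_lt _ _ gg xg) (iter_lt _ _ ff yf).
  by rewrite (iter_gt _ _ gg xg) (iter_gt _ _ ff yf).
Qed.

Lemma partial_conj_extend s x : partial_conj s -> exists s',
  [/\ partial_conj s',
    forall z w, orbits_rel g f s z w -> orbits_rel g f s' z w &
    g x <> x -> exists y, orbits_rel g f s' x y].
Proof.
move=> pc; have [H|] := pselect (g x <> x -> exists y, orbits_rel g f s x y).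
  by exists s.
move=> /not_implyP[gx nx]; have [y fy] := partial_conj_fits pc gx nx.
exists ((x, y) :: s); split => [|z w|_]; first exact: partial_conj_cons.
  case=> [?|[p ps zw]]; [by left|right; exists p => //].
  by rewrite inE ps orbT.
exists y; apply: (@orbit_rel_mem R g f ((x, y) :: s) (x, y)).
by rewrite mem_head.
Qed.

End extension.

(** * Alternating automorphisms are conjugate *)

Section limit.
Context {R : realType}.
Implicit Types (f g : R -> R) (E : R -> R -> Prop) (s : seq (R * R)).

Lemma orbits_rel_swapK f g s z w :
  orbits_rel f g (map (fun p => (p.2, p.1)) s) w z -> orbits_rel g f s z w.
Proof.
move=> /orbits_rel_swap.
by rewrite -map_comp (@eq_map _ _ _ id) ?map_id// => -[].
Qed.

Lemma partial_conj_swap f g s :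
  identity_outside g -> identity_outside f -> partial_conj g f s ->
  partial_conj f g (map (fun p => (p.2, p.1)) s).
Proof.
move=> g01 f01 pc; split => [_ /mapP[p ps ->] /=|w z w' z'].
  exact: (partial_conj_nfix g01 f01 pc ps).
move=> /orbits_rel_swapK zw /orbits_rel_swapK zw'.
by rewrite (pc.2 _ _ _ _ zw zw').
Qed.

Lemma partial_conj_step g g' f f' s x :
  order_aut g g' -> order_aut f f' ->
  identity_outside g -> identity_outside f ->
  alternating g -> alternating f -> partial_conj g f s -> exists s',
  [/\ partial_conj g f s',
    forall z w, orbits_rel g f s z w -> orbits_rel g f s' z w,
    g x <> x -> exists y, orbits_rel g f s' x y &
    f x <> x -> exists y, orbits_rel g f s' y x].
Proof.
move=> gg ff g01 f01 galt falt pc.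
have [s1 [pc1 ss1 xs1]] := partial_conj_extend gg ff g01 f01 falt x pc.
have [s2 [pc2 ss2 xs2]] := partial_conj_extend ff gg f01 g01 galt x
  (partial_conj_swap g01 f01 pc1).
have sub z w : orbits_rel g f s1 z w ->
    orbits_rel g f (map (fun p => (p.2, p.1)) s2) z w.
  by move=> /orbits_rel_swap/ss2/orbits_rel_swap.
exists (map (fun p => (p.2, p.1)) s2); split.
- exact: partial_conj_swap.
- by move=> z w /ss1/sub.
- by move=> /xs1[y /sub]; exists y.
- by move=> /xs2[y /orbits_rel_swap]; exists y.
Qed.

(** The map is H x = sup of the partners of the points below x.  Density of the
range is what prevents H from jumping over a partner. *)
Lemma order_rel_cut E : order_rel E ->
  (forall a b, a < b -> exists z w, E z w /\ a < z < b) ->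
  (forall a b, a < b -> exists z w, E z w /\ a < w < b) ->
  exists H : R -> R, forall z w x, E z w ->
    (z < x) = (w < H x) /\ (x < z) = (H x < w).
Proof.
move=> oE dom ran; pose S x := [set w | exists2 z, E z w & z < x].
have S0 x : S x !=set0.
  have [|z [w [zw /andP[_ zx]]]] := dom (x - 1) x; first lra.
  by exists w, z.
have up x z w : E z w -> x <= z -> ubound (S x) w.
  move=> zw xz v [u uv ux]; rewrite -(oE _ _ _ _ uv zw).
  by rewrite ltW// (lt_le_trans ux).
have Sb x : has_ubound (S x).
  have [|z [w [zw /andP[xz _]]]] := dom x (x + 1); first lra.
  by exists w; apply: up zw _; exact: ltW.
have lt1 z w x : E z w -> z < x -> w < sup (S x).
  move=> zw zx; have [u [v [uv /andP[zu ux]]]] := dom _ _ zx.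
  apply: (@lt_le_trans _ _ v); first by rewrite -(order_rel_lt oE zw uv).
  by apply: ub_le_sup => //; exists u.
have le1 z w x : E z w -> x <= z -> sup (S x) <= w.
  by move=> zw xz; apply: ge_sup => //; exact: up zw xz.
have lt2 z w x : E z w -> (z < x) = (w < sup (S x)).
  move=> zw; have [zx|xz] := ltP z x; first by rewrite (lt1 _ _ _ zw).
  by rewrite ltNge (le1 _ _ _ zw).
exists (fun x => sup (S x)) => z w x zw; split; first exact: lt2.
have [xz|zx] := ltP x z.
  have [u [v [uv /andP[xu uz]]]] := dom _ _ xz.
  apply/esym; apply: (@le_lt_trans _ _ v); first exact: le1 uv (ltW xu).
  by rewrite -(order_rel_lt oE uv zw).
apply/esym/negbTE/negP => Sw; have [u [v [uv /andP[Sv vw]]]] := ran _ _ Sw.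
have : v < sup (S x).
  apply: (lt1 u) => //; apply: lt_le_trans zx.
  by rewrite (order_rel_lt oE uv zw).
by rewrite ltNge ltW.
Qed.

Lemma order_rel_extend E : order_rel E ->
  (forall a b, a < b -> exists z w, E z w /\ a < z < b) ->
  (forall a b, a < b -> exists z w, E z w /\ a < w < b) ->
  exists H K, order_aut H K /\ forall z w x, E z w ->
    (z < x) = (w < H x) /\ (x < z) = (H x < w).
Proof.
move=> oE dom ran; have [H HP] := order_rel_cut oE dom ran.
have [|||K KP] := @order_rel_cut (fun w z => E z w).
- by move=> w z w' z' zw zw'; rewrite (oE _ _ _ _ zw zw').
- by move=> a b /ran[z [w ?]]; exists w, z.
- by move=> a b /dom[z [w ?]]; exists w, z.
have HK : cancel H K.
  move=> x; have [lt|lt|//] := ltgtP (K (H x)) x.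
    have [z [w [zw /andP[Kz zx]]]] := dom _ _ lt.
    move: zx; rewrite (HP _ _ _ zw).1 => wH.
    by move: Kz; rewrite -(KP _ _ _ zw).2 => /(lt_trans wH); rewrite ltxx.
  have [z [w [zw /andP[xz zK]]]] := dom _ _ lt.
  move: xz; rewrite (HP _ _ _ zw).2 => Hw.
  by move: zK; rewrite -(KP _ _ _ zw).1 => /(lt_trans Hw); rewrite ltxx.
have KH : cancel K H.
  move=> x; have [lt|lt|//] := ltgtP (H (K x)) x.
    have [z [w [zw /andP[Hw wx]]]] := ran _ _ lt.
    move: wx; rewrite (KP _ _ _ zw).1 => zK.
    by move: Hw; rewrite -(HP _ _ _ zw).2 => /(lt_trans zK); rewrite ltxx.
  have [z [w [zw /andP[xw wH]]]] := ran _ _ lt.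
  move: xw; rewrite (KP _ _ _ zw).2 => Kz.
  by move: wH; rewrite -(HP _ _ _ zw).1 => /(lt_trans Kz); rewrite ltxx.
exists H, K; split => //; split => //; apply: le_mono => x y xy.
have [z [w [zw /andP[xz zy]]]] := dom _ _ xy.
apply: (@lt_trans _ _ w); first by rewrite -(HP _ _ _ zw).2.
by rewrite -(HP _ _ _ zw).1.
Qed.

(** Points moved by g are dense, by alternation at any fixed point, and they
form an open set, hence contain rationals: the enumeration of the rationals
below only handles moved points. *)
Lemma alternating_rat g g' (a b : R) : order_aut g g' -> alternating g ->
  0 <= a -> b <= 1 -> a < b ->
  exists q : rat, a < ratr q < b /\ g (ratr q) <> ratr q.
Proof.
move=> gg galt a0 b1 ab; have gl := order_aut_lt gg.
have [x [/andP[ax xb] gx]] : exists x : R, a < x < b /\ g x <> x.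
  have [gc|gc] := pselect (g ((a + b) / 2) = (a + b) / 2); last first.
    by exists ((a + b) / 2); split => //; lra.
  have [||x [y2 [y3 [y4 [[ax x1 x2 x3 x4] [gx *]]]]]] :=
    galt _ _ gc ((b - a) / 2); [lra|lra|].
  by exists x; split; [lra | move=> e; move: gx; rewrite e ltxx].
have [gxx|xgx|//] := ltgtP (g x) x.
  have [|q] := @rat_in_itvoo R (Num.max a (g x)) x; first by rewrite gt_max ax.
  rewrite in_itv /= gt_max => /andP[/andP[aq gq] qx]; exists q.
  rewrite aq (lt_trans qx) //; split => // e.
  by move: gq; rewrite -e gl ltNge ltW.
have [|q] := @rat_in_itvoo R x (Num.min b (g x)); first by rewrite lt_min xb.
rewrite in_itv /= lt_min => /andP[xq /andP[qb qg]]; exists q.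
rewrite (lt_trans ax)//; split => // e.
by move: qg; rewrite -e gl ltNge ltW.
Qed.

(** The matchings S n increase, and the n-th step puts the n-th rational in the
domain and in the range.  Their union E is equivariant with dense domain and
range; its completion H is a conjugacy since H (g x) and f (H x) define the same
cut of the range of E. *)
Theorem alternating_conjugate g g' f f' :
  order_aut g g' -> order_aut f f' ->
  identity_outside g -> identity_outside f ->
  alternating g -> alternating f ->
  exists H K, [/\ order_aut H K, identity_outside H &
    forall x, H (g x) = f (H x)].
Proof.
move=> gg ff g01 f01 galt falt; pose T := {s | partial_conj g f s}.
have step (n : nat) (s : T) : {s' : T |
   [/\ forall z w, orbits_rel g f (sval s) z w -> orbits_rel g f (sval s') z w
    & forall q : rat, unpickle n = Some q ->
     (g (ratr q) <> ratr q -> exists y, orbits_rel g f (sval s') (ratr q) y) /\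
     (f (ratr q) <> ratr q -> exists y, orbits_rel g f (sval s') y (ratr q))]}.
  apply: cid; case: s => s pc; case: (unpickle n) => [q|]; last first.
    by exists (exist _ s pc); split.
  have [s' [pc' ss' xs' sx']] :=
    partial_conj_step (ratr q) gg ff g01 f01 galt falt pc.
  by exists (exist _ s' pc'); split => //= _ [<-].
have pc0 : partial_conj g f [::].
  by split => // z w z' w' [[-> _]|[]//] [[-> _]|[]//].
pose S := fix S n : T :=
  if n is m.+1 then sval (step m (S m)) else exist _ [::] pc0.
have Smono m n z w : (m <= n)%N -> orbits_rel g f (sval (S m)) z w ->
    orbits_rel g f (sval (S n)) z w.
  move=> /subnK <- zw; elim: (n - m)%N => // k IH.
  by have [sub _] := svalP (step (k + m)%N (S (k + m)%N)); exact: sub IH.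
pose E z w := exists n, orbits_rel g f (sval (S n)) z w.
have oE : order_rel E.
  move=> z w z' w' [m zw] [n zw'].
  have [_ o] := svalP (S (maxn m n)).
  apply: o; first by apply: Smono zw; exact: leq_maxl.
  by apply: Smono zw'; exact: leq_maxr.
have eE : equivariant_rel g' f' E.
  by move=> z w [n zw]; exists n; exact: (orbits_rel_equivariantV gg ff).
have E01 c : c <= 0 \/ 1 <= c -> E c c by move=> c01; exists 0%N; left.
have Eq (q : rat) : (g (ratr q) <> ratr q -> exists y, E (ratr q) y) /\
    (f (ratr q) <> ratr q -> exists y, E y (ratr q)).
  have [_ /(_ q (pickleK q))[P1 P2]] := svalP (step (pickle q) (S (pickle q))).
  by split => [/P1|/P2] [y Ey]; exists y, (pickle q).+1.
have dense_of (P : R -> Prop) a b : a < b ->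
    (forall c, c <= 0 \/ 1 <= c -> P c) ->
    (0 <= a -> b <= 1 -> exists2 z, P z & a < z < b) ->
    exists2 z, P z & a < z < b.
  move=> ab P01 H; have [a0|a0] := ltP a 0.
    have := ge_min b b 0; have := ge_min 0 b 0; rewrite !lexx orbT => m0 mb.
    have am : a < Num.min b 0 by rewrite lt_min ab.
    by exists ((a + Num.min b 0) / 2); [apply: P01; left; lra|lra].
  have [b1|b1] := ltP 1 b; last exact: H.
  have := le_max a a 1; have := le_max 1 a 1; rewrite !lexx orbT => m1 ma.
  have mb : Num.max a 1 < b by rewrite gt_max ab.
  by exists ((b + Num.max a 1) / 2); [apply: P01; right; lra|lra].
have dom a b : a < b -> exists z w, E z w /\ a < z < b.
  move=> ab; have [c c01|a0 b1|z [w zw] zab] :=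
    dense_of (fun z => exists w, E z w) a b ab.
  - by exists c; exact: E01.
  - have [q [qab gq]] := alternating_rat gg galt a0 b1 ab.
    by exists (ratr q) => //; exact: (Eq q).1.
  - by exists z, w.
have ran a b : a < b -> exists z w, E z w /\ a < w < b.
  move=> ab; have [c c01|a0 b1|w [z zw] wab] :=
    dense_of (fun w => exists z, E z w) a b ab.
  - by exists c; exact: E01.
  - have [q [qab fq]] := alternating_rat ff falt a0 b1 ab.
    by exists (ratr q) => //; exact: (Eq q).2.
  - by exists z, w.
have [H [K [HK HP]]] := order_rel_extend oE dom ran.
exists H, K; split => // [c c01|x].
  have := HP c c c (E01 _ c01); rewrite ltxx => -[h1 h2].
  by apply/eqP; rewrite eq_le !leNgt -h1 -h2.
have [lt|lt|//] := ltgtP (H (g x)) (f (H x)).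
- have [z [w [zw /andP[Hw wf]]]] := ran _ _ lt.
  move: Hw; rewrite -(HP _ _ _ zw).2 (order_aut_ltLR _ _ gg).
  rewrite (HP _ _ _ (eE _ _ zw)).2 -(order_aut_ltLR _ _ ff).
  by move=> /(lt_trans wf); rewrite ltxx.
- have [z [w [zw /andP[wf Hw]]]] := ran _ _ lt.
  move: Hw; rewrite -(HP _ _ _ zw).1 (order_aut_ltRL _ _ gg).
  rewrite (HP _ _ _ (eE _ _ zw)).1 -(order_aut_ltRL _ _ ff).
  by move=> /(lt_trans wf); rewrite ltxx.
Qed.

End limit.

(** * Homeomorphisms of the interval as automorphisms of the line *)

Section interval.
Context {R : realType}.
Local Notation I := (unit_interval R).
Implicit Types (f h : homeo I) (u v : I -> I) (F G : R -> R).

Lemma clip_itv (x : R) : Num.min 1 (Num.max 0 x) \in `[0%R : R, 1%R]%classic.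
Proof.
by apply/mem_set; rewrite /= in_itv /= le_min ge_min le_max !lexx ler01.
Qed.

(** Truncation gives a total left inverse of the injection of the interval into
the line. *)
Definition to_interval (x : R) : I := 
  exist (fun y : R => y \in `[0%R : R, 1%R]%classic) _ (clip_itv x).

Lemma interval_bounds (x : I) : 0 <= val x <= 1.
Proof. by have := set_mem (valP x); rewrite /= in_itv. Qed.

Lemma to_intervalK x : 0 <= x <= 1 -> val (to_interval x) = x.
Proof. by move=> /andP[x0 x1]; rewrite /= max_r// min_r. Qed.

Lemma valK_interval (x : I) : to_interval (val x) = x.
Proof. by apply: val_inj; rewrite to_intervalK// interval_bounds. Qed.

Definition extend u (x : R) : R :=
  if 0 <= x <= 1 then val (u (to_interval x)) else x.

Lemma extend_val u x : extend u (val x) = val (u x).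
Proof. by rewrite /extend interval_bounds valK_interval. Qed.

Lemma extend_bounds u x : (0 <= extend u x <= 1) = (0 <= x <= 1).
Proof.
rewrite {1 2}/extend; case: ifP => // _; exact: interval_bounds.
Qed.

Lemma interval_or (x : R) : (exists y : I, x = val y) \/ ~~ (0 <= x <= 1).
Proof.
have [x01|] := boolP (0 <= x <= 1); last by right.
by left; exists (to_interval x); rewrite to_intervalK.
Qed.

Lemma extend_out u x : ~~ (0 <= x <= 1) -> extend u x = x.
Proof. by rewrite /extend => /negbTE ->. Qed.

Lemma extend_can u v : cancel u v -> cancel (extend u) (extend v).
Proof.
move=> uK x; have [[y ->]|xo] := interval_or x.
  by rewrite !extend_val uK.
by rewrite !extend_out// extend_out.
Qed.

Lemma Hplus_order_aut f : Hplus R f ->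
  order_aut (extend f) (extend (homeo_inv f)).
Proof.
move=> fH; split; last 2 first.
- exact: extend_can (@homeo_funK _ f).
- exact: extend_can (@homeo_invK _ f).
apply: le_mono => x y xy; have [[x' xE]|xo] := interval_or x;
  have [[y' yE]|yo] := interval_or y.
- by rewrite xE yE !extend_val; apply: fH; rewrite -xE -yE.
- have := interval_bounds (f x'); rewrite -extend_val -xE (extend_out _ yo).
  by move: yo (interval_bounds x'); rewrite -xE negb_and -!ltNge; lra.
- have := interval_bounds (f y'); rewrite -extend_val -yE (extend_out _ xo).
  by move: xo (interval_bounds y'); rewrite -yE negb_and -!ltNge; lra.
- by rewrite !extend_out.
Qed.

(** The end points are fixed because they are the least and the greatest element
of the interval, which the extension and its inverse both preserve. *)
Lemma extend_outside f : Hplus R f -> identity_outside (extend f).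
Proof.
move=> fH; have FG := Hplus_order_aut fH.
have b0 u : 0 <= extend u 0.
  by have := extend_bounds u 0; rewrite lexx ler01 => /andP[].
have b1 u : extend u 1 <= 1.
  by have := extend_bounds u 1; rewrite lexx ler01 => /andP[].
have f0 : extend f 0 = 0.
  by apply/eqP; rewrite eq_le b0 (order_aut_leLR _ _ FG) b0.
have f1 : extend f 1 = 1.
  by apply/eqP; rewrite eq_le b1 (order_aut_leRL _ _ FG) b1.
move=> x; rewrite !le_eqVlt => -[/predU1P[->//|x0]|/predU1P[<-//|x1]].
  by rewrite extend_out// negb_and -!ltNge x0.
by rewrite extend_out// negb_and -!ltNge x1 orbT.
Qed.

Lemma order_aut_continuous F G x e : order_aut F G -> 0 < e ->
  exists2 d, 0 < d & forall y, `|x - y| < d -> `|F x - F y| < e.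
Proof.
move=> FG e0; have GF := order_aut_sym FG.
have h1 : G (F x - e) < x by rewrite (order_aut_ltLR _ _ GF); lra.
have h2 : x < G (F x + e) by rewrite (order_aut_ltRL _ _ GF); lra.
exists (Num.min (x - G (F x - e)) (G (F x + e) - x)).
  by rewrite lt_min; lra.
move=> y; rewrite lt_min !ltr_norml => /andP[/andP[? ?] /andP[? ?]].
have : F x - e < F y by rewrite (order_aut_ltRL _ _ FG); lra.
have : F y < F x + e by rewrite (order_aut_ltLR _ _ FG); lra.
by lra.
Qed.

Definition restrict F (x : I) : I := to_interval (F (val x)).

Lemma restrict_val F G x : order_aut F G -> identity_outside F ->
  val (restrict F x) = F (val x).
Proof.
move=> [mF _ _] F01; rewrite to_intervalK//.
have [F0 F1] : F 0 = 0 /\ F 1 = 1 by split; apply: F01; [left|right].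
by move: (val x) (interval_bounds x) => y; rewrite -{2}F0 -{2}F1 !mF.
Qed.

Lemma restrict_continuous F G : order_aut F G -> identity_outside F ->
  continuous (restrict F).
Proof.
move=> FG F01 x A /nbhs_ballP[e /= e0 eA].
have [d d0 dP] := order_aut_continuous (val x) FG e0.
apply/nbhs_ballP; exists d => //= y xy; apply: eA.
have := dP (val y) xy.
by rewrite -(restrict_val x FG F01) -(restrict_val y FG F01).
Qed.

Lemma order_aut_homeo F G : order_aut F G -> identity_outside F ->
  exists f : homeo I, [/\ Hplus R f, extend f = F & extend (homeo_inv f) = G].
Proof.
move=> FG F01; have GF := order_aut_sym FG; have [_ FK GK] := FG.
have G01 : identity_outside G by move=> x /F01; exact: order_aut_fix.
have rK : cancel (restrict F) (restrict G).
  move=> x; apply: val_inj.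
  by rewrite (restrict_val _ GF)// (restrict_val _ FG)// FK.
have rK' : cancel (restrict G) (restrict F).
  move=> x; apply: val_inj.
  by rewrite (restrict_val _ FG)// (restrict_val _ GF)// GK.
exists (Homeo rK rK' (restrict_continuous FG F01) (restrict_continuous GF G01)).
have ext H K : order_aut H K -> identity_outside H -> extend (restrict H) = H.
  move=> HK H01; apply/funext => x; have [[y ->]|xo] := interval_or x.
    by rewrite extend_val (restrict_val _ HK).
  rewrite extend_out// H01//.
  by move: xo; rewrite negb_and -!ltNge => /orP[] /ltW; [left|right].
split; [|exact: ext FG F01|exact: ext GF G01].
move=> x y xy; change (val (restrict F x) < val (restrict F y)).
by rewrite !(restrict_val _ FG)// (order_aut_lt FG).
Qed.

End interval.

(** * Conjugacy invariance *)

Section conjugacy_invariance.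
Context {R : realType}.
Local Notation I := (unit_interval R).
Implicit Types f g h : homeo I.

Lemma homeo_continuous_at h (x : I) (e : R) : 0 < e ->
  exists2 d, 0 < d &
    forall y : I, `|val x - val y| < d -> `|val (h x) - val (h y)| < e.
Proof.
move=> e0; have := homeo_cts (h := h) (nbhsx_ballx (h x) e e0).
by move=> /nbhs_ballP[d d0 dP]; exists d => // y /dP.
Qed.

Lemma homeo_monotone h : Hplus R h \/
  forall x y : I, val x < val y -> val (h y) < val (h x).
Proof.
have := @itv_continuous_inj_mono R (extend h) `[0, 1].
case.
- apply/subspace_continuousP => x; rewrite /= in_itv /= => x01.
  apply/cvgrPdist_lt => e e0.
  have [y xE] : exists y : I, x = val y.
    by exists (to_interval x); rewrite to_intervalK.
  have [d d0 dP] := homeo_continuous_at h y e0.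
  apply/nbhs_ballP; exists d => //= z xz /=; rewrite in_itv /= => z01.
  change (`|extend h x - extend h z| < e).
  rewrite xE -(to_intervalK z01) !extend_val; apply: dP.
  by rewrite to_intervalK// -xE.
- by move=> x y _ _; exact: (can_inj (extend_can (@homeo_funK _ h))).
- move=> H; left => x y xy; rewrite -(extend_val h x) -(extend_val h y).
  by apply: H => //; exact: interval_bounds.
- move=> H; right => x y xy; rewrite -(extend_val h x) -(extend_val h y).
  by apply: H => //; exact: interval_bounds.
Qed.

Lemma homeo_conjugateE g h f : g \o h = h \o f -> forall x, g (h x) = h (f x).
Proof. by move=> gh x; have := congr1 (@^~ x) gh. Qed.

Lemma conjugate_Hplus f g : Hplus R f -> homeo_conjugate g f -> Hplus R g.
Proof.
move=> fH [h /homeo_conjugateE gh] x y.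
rewrite -(homeo_invK h x) -(homeo_invK h y) !gh.
move: (homeo_inv h x) (homeo_inv h y) => {}x {}y.
case: (homeo_monotone h) => hm hxy; apply: (hm); apply: fH.
  by case: (ltgtP (val x) (val y)) hxy => // [/hm/ltW|/val_inj ->];
    rewrite ?ltxx// leNgt => /negbTE ->.
by case: (ltgtP (val x) (val y)) hxy => // [/hm/ltW|/val_inj ->];
    rewrite ?ltxx// leNgt => /negbTE ->.
Qed.

(** The four points of the pattern are moved by f, hence lie in the interval,
and the homeomorphism h carries them to a pattern near the given fixed point;
they are listed in the opposite order when h is decreasing. *)
Lemma conjugate_alternating f g : alternating (extend f) ->
  homeo_conjugate g f -> alternating (extend g).
Proof.
move=> falt [h /homeo_conjugateE gh] c c01 gc d d0.
pose z := homeo_inv h (to_interval c).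
have hz : val (h z) = c by rewrite /z homeo_invK to_intervalK.
have fz : f z = z.
  apply: (can_inj (homeo_funK h)); rewrite -gh; apply: val_inj.
  by rewrite -(extend_val g) hz.
have [e e0 eP] := homeo_continuous_at h z d0.
have near_c (t : I) : val z - e < val t -> val t < val z + e ->
    c - d < val (h t) /\ val (h t) < c + d.
  move=> zt tz; have : `|val z - val t| < e by rewrite ltr_norml; lra.
  by move/eP; rewrite hz ltr_norml; lra.
have [x1 [x2 [x3 [x4 [[a1 x12 x23 x34 x4b] [f1 f2 f3 f4]]]]]] :=
  falt _ (interval_bounds z) (etrans (extend_val f z) (congr1 _ fz)) _ e0.
have pt x : extend f x <> x -> exists t : I, x = val t.
  by case: (interval_or x) => [//|/(extend_out f)].
have pt_lt x : x < extend f x -> exists t : I, x = val t.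
  by move=> xf; apply: pt => e'; move: xf; rewrite e' ltxx.
have pt_gt x : extend f x < x -> exists t : I, x = val t.
  by move=> xf; apply: pt => e'; move: xf; rewrite e' ltxx.
have [t1 e1] := pt_lt _ f1; have [t2 e2] := pt_gt _ f2.
have [t3 e3] := pt_lt _ f3; have [t4 e4] := pt_gt _ f4.
subst x1 x2 x3 x4; rewrite !extend_val in f1 f2 f3 f4.
have [c1 c1'] : c - d < val (h t1) /\ val (h t1) < c + d.
  exact: near_c a1 (lt_trans (lt_trans (lt_trans x12 x23) x34) x4b).
have [c4 c4'] : c - d < val (h t4) /\ val (h t4) < c + d.
  exact: near_c (lt_trans a1 (lt_trans (lt_trans x12 x23) x34)) x4b.
case: (homeo_monotone h) => hm.
  exists (val (h t1)), (val (h t2)), (val (h t3)), (val (h t4)).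
  by split; split; rewrite ?extend_val ?gh//; exact: hm.
exists (val (h t4)), (val (h t3)), (val (h t2)), (val (h t1)).
by split; split; rewrite ?extend_val ?gh//; exact: hm.
Qed.

Lemma alternating_homeo_conjugate f g : Hplus R f -> Hplus R g ->
  alternating (extend f) -> alternating (extend g) -> homeo_conjugate g f.
Proof.
move=> fH gH falt galt.
have [H [K [HK H01 Hc]]] := alternating_conjugate (Hplus_order_aut fH)
  (Hplus_order_aut gH) (extend_outside fH) (extend_outside gH) falt galt.
have [h [_ hE _]] := order_aut_homeo HK H01.
exists h; apply/funext => x; apply: val_inj => /=.
rewrite -(extend_val g) -(extend_val h x) -(extend_val h) -(extend_val f).
by rewrite hE Hc.
Qed.

End conjugacy_invariance.

(** * Perturbing an automorphism at a fixed point *)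

Section perturbation.
Context {R : realType}.
Implicit Types F G : R -> R.

Lemma order_aut_shift (e : R) : order_aut (fun x => x + e) (fun y => y - e).
Proof. by split => [x y|x|x]; rewrite ?lerD2r ?addrK ?subrK. Qed.

(** The graph is a piecewise affine tent above the diagonal: the line of slope 2
through (a, a) and the line of slope 1/2 through (b, b). *)
Lemma bump (a b : R) : a < b -> exists F G, [/\ order_aut F G,
  forall x, x <= a \/ b <= x -> F x = x & forall x, a < x < b -> x < F x].
Proof.
move=> ab; eexists; eexists; split.
- apply: (order_aut_max (@order_aut_id R)); apply: order_aut_min.
    exact: (@order_aut_affine R 2 (- a)).
  exact: (@order_aut_affine R 2^-1 (b / 2)).
- move=> x xab /=; apply: max_l; rewrite ge_min; apply/orP.
  by case: xab => ?; [left|right]; lra.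
- by move=> x xab /=; rewrite lt_max lt_min; apply/orP; right; lra.
Qed.

(** Four bumps on consecutive quarters of the interval, every other one
inverted. *)
Lemma exists_alternates (a b : R) : a < b -> exists F G, [/\ order_aut F G,
  forall x, x <= a \/ b <= x -> F x = x & alternates F a b].
Proof.
move=> ab; pose u := (b - a) / 4.
have [|F1 [G1 [FG1 fix1 up1]]] := @bump a (a + u); first by rewrite /u; lra.
have [|F2 [G2 [FG2 fix2 up2]]] := @bump (a + u) (a + 2 * u).
  by rewrite /u; lra.
have [|F3 [G3 [FG3 fix3 up3]]] := @bump (a + 2 * u) (a + 3 * u).
  by rewrite /u; lra.
have [|F4 [G4 [FG4 fix4 up4]]] := @bump (a + 3 * u) b; first by rewrite /u; lra.
have FG := order_aut_comp FG1 (order_aut_comp (order_aut_sym FG2)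
  (order_aut_comp FG3 (order_aut_sym FG4))).
have gix2 x (h : x <= a + u \/ a + 2 * u <= x) := order_aut_fix FG2 (fix2 x h).
have gix4 x (h : x <= a + 3 * u \/ b <= x) := order_aut_fix FG4 (fix4 x h).
have dn2 x : a + u < x < a + 2 * u -> a + u < G2 x < x.
  move=> xu; rewrite (order_aut_ltLR _ _ (order_aut_sym FG2)) up2// andbT.
  rewrite (order_aut_ltRL _ _ (order_aut_sym FG2)) fix2; lra.
have dn4 x : a + 3 * u < x < b -> a + 3 * u < G4 x < x.
  move=> xu; rewrite (order_aut_ltLR _ _ (order_aut_sym FG4)) up4// andbT.
  rewrite (order_aut_ltRL _ _ (order_aut_sym FG4)) fix4; lra.
have uE : b = a + 4 * u by rewrite /u; lra.
have u0 : 0 < u by rewrite /u; lra.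
eexists; eexists; split; first exact: FG.
  by move=> x xab /=; rewrite gix4 ?fix3 ?gix2 ?fix1//; lra.
exists (a + u / 2), (a + 3 * u / 2), (a + 5 * u / 2), (a + 7 * u / 2).
split; first by split; lra.
split => /=.
- by rewrite gix4 ?fix3 ?gix2 ?up1//; lra.
- rewrite gix4 ?fix3; try lra.
  have [|? ?] := andP (dn2 (a + 3 * u / 2) _); first lra.
  by rewrite fix1//; lra.
- rewrite gix4; last lra.
  have := up3 (a + 5 * u / 2); have /= := order_aut_lt FG3 => lt3 h.
  have h5 := h ltac:(lra).
  by rewrite gix2 ?fix1//; lra.
- have [|? ?] := andP (dn4 (a + 7 * u / 2) _); first lra.
  by rewrite fix3 ?gix2 ?fix1//; lra.
Qed.

Lemma alternates_widen F a b a' b' : a' <= a -> b <= b' ->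
  alternates F a b -> alternates F a' b'.
Proof.
move=> aa bb [x1 [x2 [x3 [x4 [[? ? ? ? ?] ?]]]]].
by exists x1, x2, x3, x4; split => //; split => //; lra.
Qed.

Lemma alternates_eq F F' a b : {in `]a, b[, F =1 F'} ->
  alternates F a b -> alternates F' a b.
Proof.
move=> FF [x1 [x2 [x3 [x4 [[? ? ? ? ?] ?]]]]].
exists x1, x2, x3, x4; split => //.
by rewrite -!FF// in_itv /=; lra.
Qed.

(** Let K be the identity except for the pattern +, -, +, - very near c.  The
perturbation truncates K between Lo and Hi, where Lo is the larger of F x - e
and F (x - e), and Hi the smaller of F x + e and F (x + e).  The vertical
shifts bound the distance of F' to F, the horizontal ones the distance
between the inverses.  Since Lo c < c < Hi c, the truncation does nothing to K
near c. *)
Lemma perturb F G (c e d : R) : order_aut F G -> identity_outside F ->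
  0 <= c <= 1 -> F c = c -> 0 < e -> 0 < d -> exists F' G',
  [/\ order_aut F' G', identity_outside F', forall x, `|F x - F' x| <= e,
    forall x, `|G x - G' x| <= e & alternates F' (c - d) (c + d)].
Proof.
move=> FG F01 c01 Fc e0 d0.
have FGe (s : R) := order_aut_comp (order_aut_shift s) FG.
have FGe' (s : R) := order_aut_comp FG (order_aut_shift s).
have LA := order_aut_max (FGe (- e)) (FGe' (- e)).
have HA := order_aut_min (FGe e) (FGe' e).
set Lo := (X in order_aut X _) in LA; set Hi := (X in order_aut X _) in HA.
have Fl := order_aut_lt FG; have [Fm _ _] := FG.
have Loc : Lo c < c.
  rewrite /Lo /= gt_max; apply/andP; split; first lra.
  by rewrite -[ltRHS]Fc Fl; lra.
have Hic : c < Hi c.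
  rewrite /Hi /= lt_min; apply/andP; split; first lra.
  by rewrite -[ltLHS]Fc Fl; lra.
have LoF x : Lo x <= F x.
  by rewrite /Lo /= ge_max Fm; apply/andP; split; lra.
have FHi x : F x <= Hi x.
  by rewrite /Hi /= le_min Fm; apply/andP; split; lra.
have [|d1 d10 Lod] := @order_aut_continuous _ _ _ c ((c - Lo c) / 2) LA.
  by lra.
have [|d2 d20 Hid] := @order_aut_continuous _ _ _ c ((Hi c - c) / 2) HA.
  by lra.
have [r [r0 rd rd1 rd2 [rL rH]]] : exists r,
    [/\ 0 < r, r <= d, r <= d1, r <= d2 &
      r <= (c - Lo c) / 2 /\ r <= (Hi c - c) / 2].
  exists (Num.min d (Num.min (Num.min d1 d2)
    (Num.min ((c - Lo c) / 2) ((Hi c - c) / 2)))).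
  by rewrite !lt_min !ge_min !lexx ?orbT; split => //; lra.
have [a [b [ab a0 b1 ca cb]]] : exists a b : R,
    [/\ a < b, 0 <= a, b <= 1, c - r < a & b < c + r].
  exists (Num.max 0 (c - r / 2)), (Num.min 1 (c + r / 2)).
  rewrite gt_max !lt_min le_max ge_min lt_max gt_min !lexx.
  by split => //; lra.
have [K [K' [KA Kfix Kalt]]] := exists_alternates ab.
have FA := order_aut_max LA (order_aut_min KA HA).
set F' := (X in order_aut X _) in FA; set G' := (X in order_aut _ X) in FA.
have LoF' x : Lo x <= F' x by rewrite /F' le_max lexx.
have F'Hi x : F' x <= Hi x.
  by rewrite /F' ge_max ge_min lexx orbT andbT (le_trans (LoF x)).
have [_ _ GK'] := FA.
exists F', G'; split; first exact: FA.
- move=> x x01; have Fx := F01 x x01.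
  have Kx : K x = x by apply: Kfix; case: x01 => ?; [left|right]; lra.
  have := LoF x; have := FHi x; rewrite Fx => ? ?.
  by rewrite /F' /= Kx min_l// max_r.
- move=> x; have := LoF' x; have := F'Hi x.
  have : F x - e <= Lo x by rewrite /Lo le_max lexx.
  have : Hi x <= F x + e by rewrite /Hi ge_min lexx.
  by rewrite ler_norml; lra.
- move=> y; have : G' y - e <= G y.
    rewrite -(order_aut_leLR _ _ FG) -[leRHS]GK'; apply: le_trans (LoF' _).
    by rewrite /Lo le_max lexx orbT.
  have : G y <= G' y + e.
    rewrite -(order_aut_leRL _ _ FG) -[leLHS]GK'; apply: le_trans (F'Hi _) _.
    by rewrite /Hi ge_min lexx orbT.
  by rewrite ler_norml; lra.
- apply: (@alternates_widen _ a b); [lra|lra|].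
  apply: alternates_eq Kalt => x; rewrite in_itv /= => /andP[ax xb].
  have KA' := order_aut_lt KA.
  have aK : a < K x by rewrite -(Kfix a) ?KA'//; left.
  have Kb : K x < b by rewrite -(Kfix b) ?KA'//; right.
  have cx : `|c - x| < r by rewrite ltr_norml; lra.
  have := Lod x (lt_le_trans cx rd1); have := Hid x (lt_le_trans cx rd2).
  rewrite !ltr_norml => ? ?.
  by rewrite /F' /= min_l ?max_r//; lra.
Qed.

(** The absence of fixed points is stated with a uniform lower bound so that
the condition is visibly open. *)
Definition alternating_upto r d F :=
  (exists2 eta, 0 < eta &
    forall t, 0 <= t <= 1 -> `|t - r| <= d -> eta <= `|F t - t|) \/
  alternates F (r - 2 * d) (r + 2 * d).

Lemma no_fixed_gap F G (a b : R) : order_aut F G ->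
  (forall t, a <= t <= b -> F t <> t) ->
  exists2 eta, 0 < eta & forall t, a <= t <= b -> eta <= `|F t - t|.
Proof.
move=> FG nfix; have [ab|ba] := leP a b; last first.
  by exists 1 => // t; lra.
have [|c cab cmin] := @EVT_min R (fun t => `|F t - t|) a b ab.
  apply: continuous_subspaceT => x.
  apply: cvg_norm; apply: cvgB; last exact: cvg_id.
  apply/cvgrPdist_lt => e e0; have [d d0 dP] := order_aut_continuous x FG e0.
  by apply/nbhs_ballP; exists d.
exists `|F c - c|; last by move=> t tab; apply: cmin; rewrite in_itv.
rewrite normr_gt0 subr_eq0; apply/eqP; apply: nfix.
by move: cab; rewrite in_itv.
Qed.

Lemma alternating_upto_fixed F G r d : order_aut F G ->
  (exists t, [/\ 0 <= t <= 1, `|t - r| <= d & F t = t]) \/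
  alternating_upto r d F.
Proof.
move=> FG.
have [|nfix] := pselect (exists t, [/\ 0 <= t <= 1, `|t - r| <= d & F t = t]).
  by left.
right; left; have [t|eta eta0 etaP] :=
    @no_fixed_gap F G (Num.max 0 (r - d)) (Num.min 1 (r + d)) FG.
  rewrite ge_max le_min => /andP[/andP[? ?] /andP[? ?]] Ft; apply: nfix.
  by exists t; rewrite ler_norml; split => //; lra.
exists eta => // t t01; rewrite ler_norml => tr; apply: etaP.
by rewrite ge_max le_min; lra.
Qed.

Lemma alternating_uptoP F G : order_aut F G ->
  alternating F <-> forall (q : rat) n, alternating_upto (ratr q) n.+1%:R^-1 F.
Proof.
move=> FG; split => [Falt q n|H c c01 Fc d d0].
  have n0 : 0 < n.+1%:R^-1 :> R by rewrite invr_gt0.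
  move: (n.+1%:R^-1 : R) n0 => d d0.
  have [[t [t01 tq Ft]]|//] := alternating_upto_fixed (ratr q) d FG.
  right; move: tq; rewrite ler_norml => tq.
  by apply: alternates_widen (Falt t t01 Ft d d0); lra.
have [|n] := @ltr_add_invr R 0 (d / 3); first lra.
rewrite add0r => nd; have n0 : 0 < n.+1%:R^-1 :> R by rewrite invr_gt0.
move: (n.+1%:R^-1 : R) nd n0 (H^~ n) => u ud u0 {}H.
have [|q] := @rat_in_itvoo R (c - u) (c + u); first lra.
rewrite in_itv /= => qc; have [[eta eta0 etaP]|] := H q.
  by have := etaP c c01; rewrite Fc subrr normr0 ler_norml; lra.
by apply: alternates_widen; lra.
Qed.

Lemma alternating_upto_open F r d : alternating_upto r d F ->
  exists2 rho, 0 < rho &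
    forall F', (forall t, `|F t - F' t| < rho) -> alternating_upto r d F'.
Proof.
case=> [[eta eta0 etaP]|[x1 [x2 [x3 [x4 [xs [f1 f2 f3 f4]]]]]]].
  exists (eta / 2) => [|F' FF']; first lra.
  left; exists (eta / 2) => [|t t01 tr]; first lra.
  have := etaP t t01 tr; have := FF' t.
  have := ler_distD (F' t) (F t) t; lra.
exists (Num.min (Num.min (F x1 - x1) (x2 - F x2))
          (Num.min (F x3 - x3) (x4 - F x4))).
  by rewrite !lt_min; lra.
move=> F' FF'; right; exists x1, x2, x3, x4; split => //.
have := FF' x1; have := FF' x2; have := FF' x3; have := FF' x4.
by rewrite !lt_min !ltr_norml; split; lra.
Qed.

Lemma alternating_upto_dense F G r d e : order_aut F G -> identity_outside F ->
  0 < d -> 0 < e -> exists F' G',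
  [/\ order_aut F' G', identity_outside F', forall x, `|F x - F' x| <= e,
    forall x, `|G x - G' x| <= e & alternating_upto r d F'].
Proof.
move=> FG F01 d0 e0; have [[t [t01 tr Ft]]|H] := alternating_upto_fixed r d FG.
  have [F' [G' [? ? ? ? alt]]] := perturb FG F01 t01 Ft e0 d0.
  exists F', G'; split => //; right; move: tr; rewrite ler_norml => tr.
  by apply: alternates_widen alt; lra.
by exists F, G; split => // x; rewrite subrr normr0 ltW.
Qed.

End perturbation.

(** * Completeness and the category argument *)

Section completeness.
Context {R : realType}.

(** The hypothesis makes the intervals from a n - r n to a n + r n meet
pairwise, so they have a common point. *)
Lemma real_limit (a r : nat -> R) : (forall n k, `|a n - a (n + k)%N| <= r n) ->
  exists l, forall n, `|a n - l| <= r n.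
Proof.
move=> ar; have r0 n : 0 <= r n by apply: le_trans (ar n 0%N).
have cross n m : a n - r n <= a m + r m.
  have [nm|/ltnW mn] := leqP n m.
    have := ar n (m - n)%N; have := r0 m; rewrite subnKC// ler_norml; lra.
  have := ar m (n - m)%N; have := r0 n; rewrite subnKC// ler_norml; lra.
pose S := range (fun n => a n - r n).
have ub m : ubound S (a m + r m) by move=> _ [n _ <-]; exact: cross.
exists (sup S) => n.
have : a n - r n <= sup S.
  by apply: ub_le_sup; [exists (a 0%N + r 0%N)|exists n].
have : sup S <= a n + r n.
  by apply: ge_sup; [exists (a n - r n), n|exact: ub].
by rewrite ler_norml; lra.
Qed.

Definition vanishing (r : nat -> R) :=
  forall e, 0 < e -> exists N, forall n, (N <= n)%N -> r n < e.

(** If f (g x) were smaller than x, then, for m large, F m would still map some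
v' > g x below x - r m; but G k x tends to g x, so that G k x < v' and
x = F k (G k x) < F k v' <= x for k large.  The case f (g x) > x is
symmetric. *)
Lemma limit_cancel (F G : nat -> R -> R) (r : nat -> R) f g :
  (forall n, order_aut (F n) (G n)) -> vanishing r ->
  (forall n k x, `|F n x - F (n + k)%N x| <= r n) ->
  (forall n x, `|F n x - f x| <= r n) -> (forall n x, `|G n x - g x| <= r n) ->
  cancel g f.
Proof.
move=> FG r0 Fr Ff Gg x; set y := g x.
have rge n : 0 <= r n by apply: le_trans (Fr n 0%N 0).
have [lt|gt|//] := ltgtP (f y) x.
- have [|m /(_ m (leqnn m)) rm] := r0 ((x - f y) / 3); first lra.
  have Fm := Ff m y; rewrite ler_norml in Fm.
  pose v := x - 2 * r m.
  have vy : y < G m v by rewrite -(order_aut_ltLR _ _ (FG m)) /v; lra.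
  have [|N /(_ (N + m)%N (leq_addr _ _)) rk] := r0 (G m v - y); first lra.
  have Gk : G (N + m)%N x < G m v.
    by have := Gg (N + m)%N x; rewrite -/y ler_norml; lra.
  rewrite (order_aut_ltLR _ _ (order_aut_sym (FG _))) in Gk.
  have [_ _ GK] := FG m.
  have := Fr m N (G m v); rewrite addnC GK ler_norml.
  by have := rge m; rewrite /v; lra.
- have [|m /(_ m (leqnn m)) rm] := r0 ((f y - x) / 3); first lra.
  have Fm := Ff m y; rewrite ler_norml in Fm.
  pose v := x + 2 * r m.
  have vy : G m v < y by rewrite -(order_aut_ltRL _ _ (FG m)) /v; lra.
  have [|N /(_ (N + m)%N (leq_addr _ _)) rk] := r0 (y - G m v); first lra.
  have Gk : G m v < G (N + m)%N x.
    by have := Gg (N + m)%N x; rewrite -/y ler_norml; lra.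
  rewrite (order_aut_ltRL _ _ (order_aut_sym (FG _))) in Gk.
  have [_ _ GK] := FG m.
  have := Fr m N (G m v); rewrite addnC GK ler_norml.
  by have := rge m; rewrite /v; lra.
Qed.

Lemma order_aut_limit (F G : nat -> R -> R) (r : nat -> R) :
  (forall n, order_aut (F n) (G n)) -> (forall n, identity_outside (F n)) ->
  vanishing r ->
  (forall n k x, `|F n x - F (n + k)%N x| <= r n) ->
  (forall n k x, `|G n x - G (n + k)%N x| <= r n) ->
  exists f g, [/\ order_aut f g, identity_outside f,
    forall n x, `|F n x - f x| <= r n & forall n x, `|G n x - g x| <= r n].
Proof.
move=> FG F01 r0 Fr Gr.
have [f Ff] := choice (fun x => real_limit (fun n k => Fr n k x)).
have [g Gg] := choice (fun x => real_limit (fun n k => Gr n k x)).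
have fgK : cancel g f.
  by apply: (limit_cancel FG r0 Fr) => n x; [exact: Ff|exact: Gg].
have gfK : cancel f g.
  by apply: (limit_cancel (fun n => order_aut_sym (FG n)) r0 Gr) => n x;
    [exact: Gg|exact: Ff].
have fle : {homo f : x y / x <= y}.
  move=> x y xy; rewrite leNgt; apply/negP => fyx.
  have [|n /(_ n (leqnn n)) rn] := r0 ((f x - f y) / 2); first lra.
  have [mF _ _] := FG n; have : F n x <= F n y by rewrite mF.
  by have := Ff x n; have := Ff y n; rewrite !ler_norml; lra.
exists f, g; split => // [|x x01].
  split => //; apply: le_mono => x y xy; rewrite lt_neqAle fle ?ltW// andbT.
  by rewrite (can_eq gfK) lt_eqF.
have [//|ne] := eqVneq (f x) x.
have e0 : 0 < `|x - f x| by rewrite normr_gt0 subr_eq0 eq_sym.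
have [n /(_ n (leqnn n))] := r0 _ e0.
by have := Ff x n; rewrite (F01 n x x01) => /le_lt_trans h /h; rewrite ltxx.
Qed.

(** The usual nested balls: the ball chosen at step n, intersected with S, lies
in U n, and the radii are at least halved at each step, so that the distances
from a centre to the later ones add up to at most its radius. *)
Lemma baire_complete (T : metricType R) (S : set T) (U : nat -> set T) :
  (forall (u : nat -> T) r, (forall n, S (u n)) -> vanishing r ->
    (forall n k, mdist (u n) (u (n + k)%N) <= r n) ->
    exists2 f, S f & forall n, mdist (u n) f <= r n) ->
  (forall n f, S f -> U n f ->
    exists2 rho, 0 < rho & forall g, S g -> mdist f g < rho -> U n g) ->
  (forall n f e, S f -> 0 < e -> exists g, [/\ S g, mdist f g < e & U n g]) ->
  forall f e, S f -> 0 < e ->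
    exists g, [/\ S g, mdist f g < e & forall n, U n g].
Proof.
move=> Scomplete Uopen Udense f e Sf e0.
pose P (p : T * R) := S p.1 /\ 0 < p.2.
have step (n : nat) (p : {p | P p}) : {q : {p | P p} |
    [/\ mdist (sval p).1 (sval q).1 < (sval p).2 / 2,
        (sval q).2 <= (sval p).2 / 2 &
        forall g, S g -> mdist (sval q).1 g <= (sval q).2 -> U n g]}.
  apply: cid; case: p => -[x r] [/= Sx r0].
  have r20 : 0 < r / 2 by lra.
  have [y [Sy xy Uy]] := Udense n x _ Sx r20.
  have [rho rho0 rhoP] := Uopen n y Sy Uy.
  have Pq : P (y, Num.min (rho / 2) (r / 2)).
    by split => //=; rewrite lt_min; lra.
  exists (exist _ _ Pq); split => //=; first by rewrite ge_min lexx orbT.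
  move=> g Sg; rewrite le_min => /andP[yg _]; apply: rhoP => //; lra.
have P0 : P (f, e / 2) by split => //=; lra.
pose s := fix s n : {p | P p} :=
  if n is m.+1 then sval (step m (s m)) else exist _ _ P0.
pose u n := (sval (s n)).1; pose r n := (sval (s n)).2.
have Su n : S (u n) by case: (svalP (s n)).
have r0 n : 0 < r n by case: (svalP (s n)).
have uS n : mdist (u n) (u n.+1) < r n / 2 by case: (svalP (step n (s n))).
have rS n : r n.+1 <= r n / 2 by case: (svalP (step n (s n))).
have US n g : S g -> mdist (u n.+1) g <= r n.+1 -> U n g.
  by case: (svalP (step n (s n))) => _ _; apply.
have rn n : r n * n.+1%:R <= e / 2.
  elim: n => [|n IH]; first by rewrite mulr1.
  apply: le_trans IH; have := rS n; have := r0 n; rewrite -(@natr1 _ n.+1).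
  have : 1 <= n.+1%:R :> R by rewrite ler1n.
  by move: (n.+1%:R : R) (r n) (r n.+1) => x a b; nra.
have rvan : vanishing r.
  move=> d d0; have de : 0 < d / e by rewrite divr_gt0.
  have [N] := ltr_add_invr de; rewrite add0r => Nd; exists N => n Nn.
  have n0 : 0 < n.+1%:R :> R by [].
  have : r n <= e / 2 / n.+1%:R by rewrite ler_pdivlMr.
  move=> /le_lt_trans; apply.
  have : n.+1%:R^-1 <= N.+1%:R^-1 :> R by rewrite lef_pV2 ?posrE// ler_nat ltnS.
  move=> /le_lt_trans/(_ Nd); rewrite ltr_pdivlMr// => h.
  have : 0 < n.+1%:R^-1 :> R by rewrite invr_gt0.
  by move: (n.+1%:R^-1 : R) h => x; nra.
have uk n k : mdist (u n) (u (n + k)%N) <= r n.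
  elim: k n => [|k IH] n; first by rewrite addn0 mdistxx ltW.
  apply: le_trans (metric_triangle _ (u n.+1) _) _.
  rewrite addnS -addSn; have := IH n.+1; have := uS n; have := rS n; lra.
have [g Sg ug] := Scomplete u r Su rvan uk.
exists g; split => // [|n]; last exact: US.
apply: le_lt_trans (ug 0%N) _; rewrite /r /=; lra.
Qed.

End completeness.

(** * The generic class *)

Section generic.
Context {R : realType}.
Local Notation I := (unit_interval R).
Implicit Types f g h : homeo I.

Lemma extend_dist (u v : I -> I) (e : R) :
  (forall x, mdist (u x) (v x) <= e) -> 0 <= e ->
  forall t, `|extend u t - extend v t| <= e.
Proof.
move=> uv e0 t; have [[x ->]|to] := interval_or t.
  by rewrite !extend_val; exact: uv.
by rewrite !extend_out// subrr normr0.
Qed.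

Lemma dist_C0_leP f g (e : R) : mdist f g <= e <-> 0 <= e /\ forall t,
  `|extend f t - extend g t| <= e /\
  `|extend (homeo_inv f) t - extend (homeo_inv g) t| <= e.
Proof.
split => [fg|[e0 fg]].
  have e0 : 0 <= e by apply: le_trans (mdist_ge0 f g) fg.
  split => // t; split; apply: extend_dist => // x.
    exact: le_trans (dist_C0_ge f g x) fg.
  exact: le_trans (dist_C0_inv_ge f g x) fg.
apply: dist_C0_le => // x.
  by have [] := fg (val x); rewrite !extend_val.
by have [_] := fg (val x); rewrite !extend_val.
Qed.

Lemma Hplus_complete (u : nat -> homeo I) r :
  (forall n, Hplus R (u n)) -> vanishing r ->
  (forall n k, mdist (u n) (u (n + k)%N) <= r n) ->
  exists2 f, Hplus R f & forall n, mdist (u n) f <= r n.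
Proof.
move=> uH r0 ur.
have [||||f [g [fg f01 uf ug]]] := @order_aut_limit R (fun n => extend (u n))
  (fun n => extend (homeo_inv (u n))) r (fun n => Hplus_order_aut (uH n)).
- by move=> n; exact: extend_outside.
- exact: r0.
- by move=> n k x; have /dist_C0_leP[_ /(_ x)[]] := ur n k.
- by move=> n k x; have /dist_C0_leP[_ /(_ x)[]] := ur n k.
have [h [hH hf hg]] := order_aut_homeo fg f01.
exists h => // n; apply/dist_C0_leP; split.
  exact: le_trans (mdist_ge0 _ _) (ur n 0%N).
by move=> t; rewrite hf hg.
Qed.

(** The pairs of a rational centre and a radius 1/(k+1) are enumerated so as to
index the open conditions by natural numbers. *)
Definition nth_condition n : set (homeo I) := fun f =>
  if @unpickle (rat * nat)%type n is Some (q, k)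
  then alternating_upto (ratr q) k.+1%:R^-1 (extend f) else True.

Lemma nth_conditionP f : Hplus R f ->
  alternating (extend f) <-> forall n, nth_condition n f.
Proof.
move=> fH; rewrite (alternating_uptoP (Hplus_order_aut fH)); split => H.
  by move=> n; rewrite /nth_condition; case: unpickle => [[q k]|].
by move=> q k; have := H (pickle (q, k)); rewrite /nth_condition pickleK.
Qed.

Lemma nth_condition_open n f : nth_condition n f ->
  exists2 rho, 0 < rho & forall g, mdist f g < rho -> nth_condition n g.
Proof.
rewrite /nth_condition; case: unpickle => [[q k]|] //; last by exists 1.
move=> /alternating_upto_open[rho rho0 rhoP]; exists rho => // g fg.
apply: rhoP => t; apply: le_lt_trans fg.
by have /dist_C0_leP[_ /(_ t)[]] := lexx (mdist f g).
Qed.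

Lemma nth_condition_dense n f e : Hplus R f -> 0 < e ->
  exists g, [/\ Hplus R g, mdist f g < e & nth_condition n g].
Proof.
rewrite /nth_condition; case: unpickle => [[q k]|] fH e0; last first.
  by exists f; rewrite mdistxx.
have k0 : 0 < k.+1%:R^-1 :> R by rewrite invr_gt0.
have e20 : 0 < e / 2 by lra.
have [F [G [FG F01 fF fG alt]]] := alternating_upto_dense (ratr q)
  (Hplus_order_aut fH) (extend_outside fH) k0 e20.
have [g [gH gF gG]] := order_aut_homeo FG F01.
exists g; rewrite gF; split => //; apply: (@le_lt_trans _ _ (e / 2)); last lra.
by apply/dist_C0_leP; rewrite gF gG; split; [exact: ltW|].
Qed.

Lemma alternating_dense f e : Hplus R f -> 0 < e ->
  exists g, [/\ Hplus R g, mdist f g < e & alternating (extend g)].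
Proof.
move=> fH e0.
have [|||g [gH fg gn]] :=
  @baire_complete R _ (Hplus R) nth_condition _ _ _ f e fH e0.
- exact: Hplus_complete.
- move=> n g gH /nth_condition_open[rho rho0 H]; exists rho => // h _; exact: H.
- by move=> n g d; exact: nth_condition_dense.
by exists g; split => //; apply/nth_conditionP.
Qed.

End generic.

Theorem theorem2p1 (R : realType) :
  exists f : homeo (unit_interval R),
    [/\ Hplus R f,
        conjugacy_class f `<=` Hplus R,
        dense (set_val @^-1` conjugacy_class f : set (Hplus R)) &
        Gdelta (set_val @^-1` conjugacy_class f : set (Hplus R))].
Proof.
have [id0 [id0H _ _]] := order_aut_homeo (@order_aut_id R) (fun _ _ => erefl).
have [f [fH _ falt]] := alternating_dense id0H ltr01.
exists f; split => //.
- by move=> g; exact: conjugate_Hplus.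
- move=> O [g Og] oO.
  have /nbhs_ballP[e /= e0 eO] := open_nbhs_nbhs (conj oO Og).
  have [h [hH gh halt]] := alternating_dense (set_mem (valP g)) e0.
  exists (exist _ h (mem_set hH)); split.
    by apply: eO; rewrite /ball /= /initial_ball ballEmdist.
  exact: alternating_homeo_conjugate.
- exists (fun n => set_val @^-1` nth_condition n).
    move=> n; rewrite openE => g /nth_condition_open[e e0 eP].
    apply/nbhs_ballP; exists e => //= h gh; apply: eP.
    by move: gh; rewrite /ball /= /initial_ball ballEmdist.
  apply/seteqP; split => g; have gH := set_mem (valP g).
    move=> gf n _; apply: (nth_conditionP gH).1.
    exact: conjugate_alternating gf.
  move=> gn; apply: alternating_homeo_conjugate => //.
  by apply/(nth_conditionP gH) => n; exact: gn.
Qed.
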